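(* Let $p$ be an odd prime. Let $Q=\bigoplus_{i\in\mathbb N}\pi^iQ_i\oplus L+c$, where each $Q_i$ is a unimodular quadratic form over $R$ of rank $r_i$ and discriminant $d_i$ (the $Q_i$ and $L$ involving pairwise disjoint sets of variables), there is a positive integer $\omega$ with $Q_i=0$ for $i>\omega$, $L$ is a linear form involving at most one indeterminate, and $c\in R$. For $j\in\mathbb N$ put $Q_{(j)}=\bigoplus_{0\le i\le j,\ i\equiv j \ (\mathrm{mod}\ 2)}Q_i$, $r_{(j)}=\sum_{0\le i\le j,\ i\equiv j\ (\mathrm{mod}\ 2)}r_i$, $d_{(j)}=\prod_{0\le i\le j,\ i\equiv j\ (\mathrm{mod}\ 2)}d_i$ (the discriminant of $Q_{(j)}$), and $q_{(j)}=q^{\sum_{0\le i<j}r_{(i)}}$. For $r\in\mathbb N$, a unit square class $d$ and $a\in R$ define $I_a(r,d)$ as follows, writing $\rho=\frac{1-1/q}{1-t/q}$: if $r$ is odd and $\pi\mid a$: $I_a(r,d)=\left(1-\frac{t}{q^r}\right)\rho$; if $r$ is odd and $\pi\nmid a$: $I_a(r,d)=\left(1+\frac{\eta(a(-1)^{(r+1)/2}d)}{q^{(r+1)/2}}t\right)\rho-\frac{1}{q^r}-\frac{\eta(a(-1)^{(r+1)/2}d)}{q^{(r+1)/2}}$; if $r$ is even and $\pi\mid a$: $I_a(r,d)=\left(1-\frac{\eta((-1)^{r/2}d)}{q^{r/2}}\right)\left(1+\frac{\eta((-1)^{r/2}d)}{q^{r/2}}t\right)\rho$; if $r$ is even and $\pi\nmid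 a$: $I_a(r,d)=\left(1-\frac{\eta((-1)^{r/2}d)}{q^{r/2}}\right)\left(\rho+\frac{\eta((-1)^{r/2}d)}{q^{r/2}}\right)$. Then the Igusa local zeta function $Z_Q(t)$ of $Q$ is as follows. (1) If $L=0$ and $c=0$, then with $r=\sum_i r_i$, $$Z_Q(t)=\sum_{0\le i<\omega-1}\frac{t^i}{q_{(i)}}I_0(r_{(i)},d_{(i)})+\left(\frac{t^{\omega-1}}{q_{(\omega-1)}}I_0(r_{(\omega-1)},d_{(\omega-1)})+\frac{t^{\omega}}{q_{(\omega)}}I_0(r_{(\omega)},d_{(\omega)})\right)\left(1-\frac{t^2}{q^r}\right)^{-1}.$$ (2) If $L(x)=bx$ with $v_\pi(b)=\lambda<\infty$ and $v_\pi(c)\ge v_\pi(b)$, then $$Z_Q(t)=\sum_{0\le i<\lambda}\frac{t^i}{q_{(i)}}I_0(r_{(i)},d_{(i)})+\frac{t^\lambda}{q_{(\lambda)}}\cdot\frac{1-1/q}{1-t/q}.$$ (3) If $L(x)=bx$ with $v_\pi(b)>v_\pi(c)$ (this includes $L=0$, $c\neq0$), then with $\kappa=v_\pi(c)$, $$Z_Q(t)=\sum_{0\le i\le\kappa}\frac{t^i}{q_{(i)}}I_{c/\pi^i}(r_{(i)},d_{(i)})+\frac{t^\kappa}{q_{(\kappa+1)}}.$$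
   Context: $K$ is a $p$-adic field (finite extension of $\mathbb Q_p$) with valuation ring $R$, uniformizer $\pi$, residue field $\mathbb F_q$, valuation $v_\pi$ with $v_\pi(0)=\infty$. For $f\in R[x_1,\dots,x_n]$ the Igusa local zeta function is $Z_f(s)=\int_{R^n}|f(x)|_K^s\,dx$ (Haar measure, $\mathrm{Vol}(R^n)=1$, $|a|_K=q^{-v_\pi(a)}$); with $t=q^{-s}$ it equals $Z_f(t)=\sum_{k\ge0}\mathrm{Vol}\{x\in R^n:v_\pi(f(x))=k\}t^k$. A quadratic form over $R$ is $x^TMx$ with $M$ a symmetric matrix over $R$; it is unimodular if $\det M\in R^*$ (the zero form counts as unimodular of rank 0, discriminant 1); its rank is the rank of $M$ and its discriminant is the class of $\det M$ in $K^*/R^{*2}\cup\{0\}$. The notation $\oplus$ denotes a sum of polynomials in disjoint sets of variables. For odd $p$, $\eta(b)=1$ if $b\in R^{*2}$, $\eta(b)=-1$ if $b\in R^*\setminus R^{*2}$, $\eta(b)=0$ if $\pi\mid b$; it is applied to square classes of units. *)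

(* Defs.v *)
From HB Require Import structures.
From mathcomp Require Import all_boot all_order all_algebra all_field.
From mathcomp Require Import all_classical all_reals all_analysis.
From mathcomp Require Import complex.

Set Implicit Arguments.
Unset Strict Implicit.
Unset Printing Implicit Defensive.

Import Order.TTheory GRing.Theory Num.Theory.
Import numFieldNormedType.Exports.

Local Open Scope classical_set_scope.
Local Open Scope ring_scope.
Local Open Scope complex_scope.

(* Valuations take values in \bar int, i.e. Z with infinities, so that
   v 0 = +oo literally; -oo is excluded by [nv_ninfty]. *)
Record normalized_valuation (K : fieldType) (v : K -> \bar int) : Prop := {
  nv_infty : forall x : K, v x = +oo%E <-> x = 0 ;
  nv_ninfty : forall x : K, v x <> -oo%E ;
  nvM : forall x y : K, v (x * y) = (v x + v y)%E ;
  nvD : forall x y : K, (mine (v x) (v y) <= v (x + y)%R)%E ;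
  nv_norm : exists x : K, v x = 1%:E }.

Definition padic_val (p : nat) (x : rat) : \bar int :=
  if x == 0 then +oo%E
  else ((logn p `|numq x|)%:Z - (logn p `|denq x|)%:Z)%:E.

Definition valuation_complete (K : fieldType) (v : K -> \bar int) : Prop :=
  forall u : nat -> K,
    (forall N : int, exists n0 : nat, forall m n : nat,
       (n0 <= m)%N -> (n0 <= n)%N -> (N%:E <= v (u m - u n)%R)%E) ->
    exists l : K, forall N : int, exists n0 : nat, forall n : nat,
      (n0 <= n)%N -> (N%:E <= v (u n - l)%R)%E.

(* (Qp, vp) is the completion of Q for the p-adic valuation; this determines
   it up to a unique isomorphism of valued fields. *)
Record is_Qp (p : nat) (Qp : fieldType) (vp : Qp -> \bar int) : Prop := {
  Qp_valuation : normalized_valuation vp ;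
  Qp_extends : forall x : rat, vp (ratr x) = padic_val p x ;
  Qp_dense : forall (x : Qp) (N : int),
    exists y : rat, (N%:E <= vp (x - ratr y)%R)%E ;
  Qp_complete : valuation_complete vp }.

(* The finiteness of K over Q_p is carried by the type [fieldExtType Qp];
   v is the normalized valuation of K, and e below is the ramification index. *)
Record padic_field (p : nat) (Qp : fieldType) (vp : Qp -> \bar int)
    (K : fieldExtType Qp) (v : K -> \bar int) : Prop := {
  pf_base : is_Qp p vp ;
  pf_valuation : normalized_valuation v ;
  pf_extends : exists2 e : nat, (0 < e)%N &
    forall x : Qp, v (x%:A) = (vp x *+ e)%E }.

Definition valring (K : fieldType) (v : K -> \bar int) : {pred K} :=
  [pred x : K | (0 <= v x)%E].

(* [red] is only meaningful on the valuation ring; its values elsewhere are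
   unconstrained. *)
Record residue_map (K : fieldType) (v : K -> \bar int) (F : finFieldType)
    (red : K -> F) : Prop := {
  red1 : red 1 = 1 ;
  redD : {in valring v &, {morph red : x y / x + y}} ;
  redM : {in valring v &, {morph red : x y / x * y}} ;
  red_surj : forall z : F, exists2 x : K, x \in valring v & red x = z ;
  red_ker : {in valring v, forall x : K, red x = 0 <-> (0 < v x)%E} }.

Definition affine (K : fieldType) (n : nat) : Type := 'rV[K]_n.
HB.instance Definition _ (K : fieldType) (n : nat) :=
  Choice.on (affine K n).
HB.instance Definition _ (K : fieldType) (n : nat) :=
  isPointed.Build (affine K n) (0 : 'rV[K]_n).

Definition vopen (K : fieldType) (v : K -> \bar int) (n : nat) :
    set (set (affine K n)) :=
  [set U | forall x : 'rV[K]_n, U x -> exists N : int, forall y : 'rV[K]_n,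
     (forall j, (N%:E <= v (y 0 j - x 0 j)%R)%E) -> U y].
Arguments vopen {K} v n.

Definition borel_affine (K : fieldType) (v : K -> \bar int) (n : nat) :=
  g_sigma_algebraType (vopen v n).

Definition int_points (K : fieldType) (v : K -> \bar int) (n : nat) :
    set (borel_affine v n) :=
  [set x : 'rV[K]_n | forall j, x 0 j \in valring v].
Arguments int_points {K} v n.

(* Haar measure on K^n, normalized so that R^n has volume 1. *)
Definition haar (R : realType) (K : fieldType) (v : K -> \bar int) (n : nat)
    (mu : {measure set (borel_affine v n) -> \bar R}) : Prop :=
  (forall (a : 'rV[K]_n) (A : set (borel_affine v n)), measurable A ->
     mu [set (a + x : 'rV[K]_n) | x in A] = mu A)
  /\ mu (int_points v n) = 1%E.

Definition vabs (R : realType) (K : fieldType) (v : K -> \bar int) (q : nat)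
    (x : K) : R :=
  if v x is k%:E then (q%:R : R) ^ (- k) else 0.

(* a ^ s for a real number a >= 0 and a complex number s, with 0 ^ s = 0. *)
Definition cpow (R : realType) (a : R) (s : R[i]) : R[i] :=
  if a == 0 then 0 else
  let y := complex.Im s * ln a in
  (expR (complex.Re s * ln a))%:C * (cos y +i* sin y).

Definition igusa_zeta (R : realType) (K : fieldType) (v : K -> \bar int)
    (q n : nat) (mu : {measure set (borel_affine v n) -> \bar R})
    (f : 'rV[K]_n -> K) (s : R[i]) : R[i] :=
  Rintegral mu (int_points v n) (fun x => complex.Re (cpow (vabs R v q (f x)) s))
  +i*
  Rintegral mu (int_points v n) (fun x => complex.Im (cpow (vabs R v q (f x)) s)).

Definition igusa_vol (R : realType) (K : fieldType) (v : K -> \bar int)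
    (n : nat) (mu : {measure set (borel_affine v n) -> \bar R})
    (f : 'rV[K]_n -> K) (k : nat) : R :=
  fine (mu (int_points v n `&` [set x | v (f x) = (k%:Z)%:E])).

(* Z is the Igusa zeta function of f in the variable t = q ^ (- s): both the
   integral over Re s > 0 and the power series in t over |t| < 1 are given
   by Z. *)
Definition igusa_zeta_is (R : realType) (K : fieldType) (v : K -> \bar int)
    (q n : nat) (mu : {measure set (borel_affine v n) -> \bar R})
    (f : 'rV[K]_n -> K) (Z : R[i] -> R[i]) : Prop :=
  (forall s : R[i], 0 < complex.Re s ->
     igusa_zeta q mu f s = Z (cpow q%:R (- s)))
  /\ (forall t : R[i], `|t| < 1 ->
     (series (fun k : nat => (igusa_vol mu f k)%:C * t ^+ k : (R[i])^o)
       : nat -> (R[i])^o) @ \oo --> (Z t : (R[i])^o)).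

Definition unimodular (K : fieldType) (v : K -> \bar int) (r : nat)
    (M : 'M[K]_r) : Prop :=
  [/\ M^T = M, M \is a mxOver (valring v) & v (\det M) = 0%:E].

Definition quad_form (K : fieldType) (r : nat) (M : 'M[K]_r) (x : 'rV[K]_r) : K :=
  (x *m M *m x^T) 0 0.

(* The form (+)_i pi^i Q_i (+) L + c, where Q_i has Gram matrix M i: the
   coordinates of x are split into consecutive blocks of sizes
   r 0, ..., r w, m, and L is the column of coefficients of a linear form in
   the last m variables. *)
Definition direct_sum_poly (K : fieldType) (pi : K) (w : nat) (r : nat -> nat)
    (M : forall i : nat, 'M[K]_(r i)) (m : nat) (L : 'cV[K]_m) (c : K)
    (x : 'rV[K]_(\sum_(i < w.+1) r i + m)) : K :=
  \sum_(i < w.+1) pi ^+ i * quad_form (M i) (submxrow (lsubmx x) i)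
  + (rsubmx x *m L) 0 0 + c.

Definition rk_upto (r : nat -> nat) (j : nat) : nat :=
  (\sum_(0 <= i < j.+1 | i == j %[mod 2]) r i)%N.

(* Discriminants are represented by determinants; [eta] below only depends on
   the class modulo squares of units. *)
Definition disc_upto (K : fieldType) (r : nat -> nat)
    (M : forall i : nat, 'M[K]_(r i)) (j : nat) : K :=
  \prod_(0 <= i < j.+1 | (i == j %[mod 2])%N) \det (M i).

Definition q_upto (q : nat) (r : nat -> nat) (j : nat) : nat :=
  (q ^ (\sum_(0 <= i < j) rk_upto r i))%N.

Definition eta (K : fieldType) (v : K -> \bar int) (b : K) : int :=
  if `[< exists2 u : K, v u = 0%:E & b = u ^+ 2 >] then 1
  else if v b == 0%:E then -1 else 0.

Definition rho (R : realType) (q : nat) (t : R[i]) : R[i] :=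
  (1 - 1 / q%:R) / (1 - t / q%:R).

Definition I_int (R : realType) (K : fieldType) (v : K -> \bar int) (q : nat)
    (a : K) (r : nat) (d : K) (t : R[i]) : R[i] :=
  if odd r then
    if (0 < v a)%E then (1 - t / q%:R ^+ r) * rho q t
    else
      let h := (eta v (a * (-1) ^+ r.+1./2 * d))%:~R / q%:R ^+ r.+1./2 in
      (1 + h * t) * rho q t - 1 / q%:R ^+ r - h
  else
    let h := (eta v ((-1) ^+ r./2 * d))%:~R / q%:R ^+ r./2 in
    if (0 < v a)%E then (1 - h) * (1 + h * t) * rho q t
    else (1 - h) * (rho q t + h).

(* The factor t^i / q_(i) * I_a(r_(i), d_(i)). *)
Definition I_term (R : realType) (K : fieldType) (v : K -> \bar int) (q : nat)
    (r : nat -> nat) (M : forall i : nat, 'M[K]_(r i)) (a : K) (i : nat)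
    (t : R[i]) : R[i] :=
  t ^+ i / (q_upto q r i)%:R * I_int v q a (rk_upto r i) (disc_upto M i) t.

(* Main.v *)
Require Import Defs.
From mathcomp Require Import all_boot all_order all_algebra all_fingroup all_solvable all_field.
From mathcomp Require Import all_classical all_reals all_analysis.
From mathcomp Require Import measurable_realfun complex.
From mathcomp Require Import zify ring lra.

(** No Jacobian is ever computed: a rescaling changes the measure, not the domain. Each step pushes
    the current measure forward by a linear map; the result is again translation invariant, and the
    mass it gives to the integral points is the old one times q^(-rank), the share of points whose
    active coordinates are divisible by pi. The product of these factors is 1/q_(j). The polynomial
    stays diagonal throughout, and only the exponents of pi, the linear coefficients and the
    constant move. The three cases differ in how the recursion ends. A linear coefficient of
    valuation l, or a constant of valuation k, becomes a unit after l or k steps and settles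
    everything that is left. If L = 0 and c = 0 it never ends; but from index w - 1 on rank and
    discriminant are 2-periodic, and two steps multiply a term by t^2 / q^r, which is the source of
    the geometric factor. The part not yet treated after J steps has coefficients at most 1 and
    lives in degrees at least J, so it disappears in the limit for |t| < 1. *)

(* Only translation invariance of Haar measure is used.  A unimodular form is
   diagonalised over the valuation ring (2 is a unit), so that Q becomes
   f = sum_i pi^(e_i) u_i x_i^2 + (linear) + c with units u_i, and R^n is cut
   into shells.  At step j the active variables are those with e_i <= j and
   e_i = j mod 2; the points with all active variables divisible by pi are
   rescaled, which divides f by pi and exchanges the two parities.  On the
   remaining shell the reduction of f is smooth: translating a residue class by
   pi^k s along a variable with unit derivative shifts f / pi^k mod pi by an
   arbitrary residue, so the volumes of the sets v(f) >= k form a geometric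
   progression.  The first volume is the number of nonzero solutions of a
   diagonal quadratic equation over the residue field, which gives I_a(r, d).
   Finally, eta is computed in the residue field by Hensel's lemma for squares,
   for which K has to be shown complete as a finite extension of Q_p. *)

Set Implicit Arguments.
Unset Strict Implicit.
Unset Printing Implicit Defensive.

Import Order.TTheory GRing.Theory Num.Theory.
Import numFieldNormedType.Exports.

Local Open Scope classical_set_scope.
Local Open Scope ring_scope.
Local Open Scope complex_scope.

(** * Valuations, residues and completeness *)

Definition vdvd (K : fieldType) (v : K -> \bar int) (k : nat) (x : K) : bool :=
  ((k%:Z)%:E <= v x)%E.

Section ValuationTheory.
Variables (K : fieldType) (v : K -> \bar int).
Hypothesis hv : normalized_valuation v.

Lemma valuation0 : v 0 = +oo%E. Proof. exact/(nv_infty hv). Qed.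

Lemma val_fin x : x != 0 -> exists a : int, v x = a%:E.
Proof.
move=> /eqP x0; case E: (v x) => [a| |]; first by exists a.
- by move/(nv_infty hv): E.
- by move/(nv_ninfty hv): E.
Qed.

Lemma valuation1 : v 1 = 0%:E.
Proof.
have [a Ea] := val_fin (oner_neq0 K).
have := nvM hv 1 1; rewrite mulr1 Ea -EFinD => -[] e.
by congr _%:E; lia.
Qed.

Lemma valuationN x : v (- x) = v x.
Proof.
have E : v (-1) = 0%:E.
  have [|a Ea] := @val_fin (-1); first by rewrite oppr_eq0 oner_eq0.
  have := nvM hv (-1) (-1); rewrite mulrNN mulr1 valuation1 Ea -EFinD => -[] e.
  by congr _%:E; lia.
by rewrite -mulN1r (nvM hv) E add0e.
Qed.

Lemma valuationX x (a : int) k : v x = a%:E -> v (x ^+ k) = (a * k%:Z)%:E.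
Proof.
move=> E; elim: k => [|k IH]; first by rewrite expr0 valuation1 mulr0.
by rewrite exprS (nvM hv) IH E -EFinD; congr _%:E; lia.
Qed.

Lemma val_ge_add (N : int) x y :
  (N%:E <= v x)%E -> (N%:E <= v y)%E -> (N%:E <= v (x + y)%R)%E.
Proof.
by move=> hx hy; apply: le_trans (nvD hv x y); rewrite le_min hx hy.
Qed.

Lemma val_ge_sub (N : int) x y :
  (N%:E <= v x)%E -> (N%:E <= v y)%E -> (N%:E <= v (x - y)%R)%E.
Proof. by move=> hx hy; apply: val_ge_add; rewrite ?valuationN. Qed.

Lemma val_eq0 x : (forall N : int, (N%:E <= v x)%E) -> x = 0.
Proof.
move=> h; apply/eqP/negPn/negP => /val_fin [a Ea].
by have := h (a + 1); rewrite Ea lee_fin; lia.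
Qed.

Lemma vdvd0 k : vdvd v k 0. Proof. by rewrite /vdvd valuation0 leey. Qed.
Lemma vdvd_int x : vdvd v 0 x = (x \in valring v). Proof. by []. Qed.
Lemma vdvd1 : vdvd v 0 1. Proof. by rewrite /vdvd valuation1. Qed.
Lemma vdvdN k x : vdvd v k (- x) = vdvd v k x.
Proof. by rewrite /vdvd valuationN. Qed.
Lemma vdvdD k x y : vdvd v k x -> vdvd v k y -> vdvd v k (x + y).
Proof. exact: val_ge_add. Qed.
Lemma vdvdB k x y : vdvd v k x -> vdvd v k y -> vdvd v k (x - y).
Proof. exact: val_ge_sub. Qed.
Lemma vdvdDr k x y : vdvd v k x -> vdvd v k (x + y) = vdvd v k y.
Proof.
move=> hx; apply/idP/idP; last exact: vdvdD.
by move=> h; rewrite -(addKr x y); apply: vdvdD => //; rewrite vdvdN.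
Qed.
Lemma vdvdM j k x y : vdvd v j x -> vdvd v k y -> vdvd v (j + k) (x * y).
Proof.
rewrite /vdvd (nvM hv) PoszD EFinD => hx hy; exact: leeD.
Qed.
Lemma vdvdMl k x y : vdvd v k x -> vdvd v 0 y -> vdvd v k (x * y).
Proof. by move=> hx hy; have := vdvdM hx hy; rewrite addn0. Qed.
Lemma vdvdX x k : vdvd v 0 x -> vdvd v 0 (x ^+ k).
Proof.
by move=> hx; elim: k => [|k IH]; [exact: vdvd1 | rewrite exprS vdvdMl].
Qed.
Lemma vdvdW j k x : (j <= k)%N -> vdvd v k x -> vdvd v j x.
Proof. by move=> jk; apply: le_trans; rewrite lee_fin lez_nat. Qed.
Lemma vdvd_sum (I : Type) (s : seq I) (P : pred I) (E : I -> K) k :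
  (forall i, P i -> vdvd v k (E i)) -> vdvd v k (\sum_(i <- s | P i) E i).
Proof. by move=> h; elim/big_ind: _ => //; [exact: vdvd0 | exact: vdvdD]. Qed.
Lemma vdvd_nat k : vdvd v 0 k%:R.
Proof.
elim: k => [|k IH]; first exact: vdvd0.
by rewrite -natr1 vdvdD // vdvd1.
Qed.

Lemma vdvd_unitV u : v u = 0%:E -> v u^-1 = 0%:E.
Proof.
move=> hu; have u0 : u != 0.
  by apply/eqP => /(nv_infty hv); rewrite hu.
by have := nvM hv u u^-1; rewrite divff // valuation1 hu add0e => <-.
Qed.
Lemma vdvd_unit u k x : v u = 0%:E -> vdvd v k (u * x) = vdvd v k x.
Proof. by move=> hu; rewrite /vdvd (nvM hv) hu add0e. Qed.
Lemma unit_vdvd u : v u = 0%:E -> vdvd v 0 u.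
Proof. by rewrite /vdvd => ->. Qed.
Lemma unit_neq0 u : v u = 0%:E -> u != 0.
Proof. by move=> hu; apply/eqP => /(nv_infty hv); rewrite hu. Qed.

Lemma val_eq_nat k x : (v x = (k%:Z)%:E) <-> vdvd v k x && ~~ vdvd v k.+1 x.
Proof.
rewrite /vdvd; split=> [->|]; first by rewrite !lee_fin; lia.
by case: (v x) => [a| |] //; rewrite ?leey ?andbF // !lee_fin => h; congr _%:E; lia.
Qed.

Lemma val_unitE x : vdvd v 0 x -> (v x = 0%:E) <-> ~~ vdvd v 1 x.
Proof. by move=> hx; rewrite (val_eq_nat 0) hx. Qed.

Lemma val_nat_or0 x : vdvd v 0 x -> x != 0 -> exists k : nat, v x = (k%:Z)%:E.
Proof.
by move=> hx /val_fin [[k|k] E]; [exists k | move: hx; rewrite /vdvd E].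
Qed.

Variable pi : K.
Hypothesis hpi : v pi = 1%:E.

Lemma pi_neq0 : pi != 0.
Proof. by apply/eqP => /(nv_infty hv); rewrite hpi. Qed.
Lemma piX_neq0 k : pi ^+ k != 0. Proof. by rewrite expf_neq0 // pi_neq0. Qed.
Lemma val_piX k : v (pi ^+ k) = (k%:Z)%:E.
Proof. by rewrite (valuationX _ hpi) mul1r. Qed.
Lemma vdvd_piX k : vdvd v k (pi ^+ k). Proof. by rewrite /vdvd val_piX. Qed.

Lemma vdvd_piM k j x : vdvd v (k + j) (pi ^+ k * x) = vdvd v j x.
Proof.
rewrite /vdvd (nvM hv) val_piX; case: (v x) => [a| |] //=.
by rewrite -EFinD !lee_fin; lia.
Qed.

Lemma vdvd_piV k j x : vdvd v (k + j) x = vdvd v j (x / pi ^+ k).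
Proof. by rewrite -[RHS](vdvd_piM k) mulrC divfK // piX_neq0. Qed.

Lemma val_eq_piM k j x : v (pi ^+ k * x) = (Posz (k + j))%:E <-> v x = (j%:Z)%:E.
Proof. by rewrite !val_eq_nat -addnS !vdvd_piM. Qed.

End ValuationTheory.

(** * Reduction modulo the maximal ideal *)

Section Residue.
Variables (K : fieldType) (v : K -> \bar int).
Hypothesis hv : normalized_valuation v.
Variables (F : finFieldType) (red : K -> F).
Hypothesis hred : residue_map v red.

Lemma red0 : red 0 = 0.
Proof. by apply/(red_ker hred); rewrite ?inE (valuation0 hv) ?leey ?ltey. Qed.
Lemma redD' x y : vdvd v 0 x -> vdvd v 0 y -> red (x + y) = red x + red y.
Proof. exact: redD hred _ _. Qed.
Lemma redM' x y : vdvd v 0 x -> vdvd v 0 y -> red (x * y) = red x * red y.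
Proof. exact: redM hred _ _. Qed.
Lemma redN x : vdvd v 0 x -> red (- x) = - red x.
Proof.
move=> hx; apply/eqP; rewrite -addr_eq0 -redD' ?(vdvdN hv) //.
by rewrite addNr red0.
Qed.
Lemma redX x k : vdvd v 0 x -> red (x ^+ k) = red x ^+ k.
Proof.
move=> hx; elim: k => [|k IH]; first by rewrite !expr0 (red1 hred).
by rewrite !exprS redM' ?IH // (vdvdX hv).
Qed.
Lemma red_sum (I : Type) (s : seq I) (P : pred I) (E : I -> K) :
  (forall i, P i -> vdvd v 0 (E i)) ->
  red (\sum_(i <- s | P i) E i) = \sum_(i <- s | P i) red (E i).
Proof.
move=> h; suff: vdvd v 0 (\sum_(i <- s | P i) E i) /\
  red (\sum_(i <- s | P i) E i) = \sum_(i <- s | P i) red (E i) by case.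
apply: (big_rec2 (fun x y => vdvd v 0 x /\ red x = y)).
  by rewrite (vdvd0 hv) red0.
by move=> i x y Pi [hx <-]; rewrite redD' ?(vdvdD hv) // h.
Qed.
Lemma red_prod (I : Type) (s : seq I) (P : pred I) (E : I -> K) :
  (forall i, P i -> vdvd v 0 (E i)) ->
  red (\prod_(i <- s | P i) E i) = \prod_(i <- s | P i) red (E i).
Proof.
move=> h; suff: vdvd v 0 (\prod_(i <- s | P i) E i) /\
  red (\prod_(i <- s | P i) E i) = \prod_(i <- s | P i) red (E i) by case.
apply: (big_rec2 (fun x y => vdvd v 0 x /\ red x = y)).
  by rewrite (vdvd1 hv) (red1 hred).
by move=> i x y Pi [hx <-]; rewrite redM' ?(vdvdMl hv) // h.
Qed.

Lemma red_eq0 x : vdvd v 0 x -> (red x == 0) = vdvd v 1 x.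
Proof.
move=> hx; have hx' : x \in valring v by [].
have E : (0 < v x)%E = vdvd v 1 x.
  by rewrite /vdvd; case: (v x) => [a| |] //; rewrite ?leey ?ltey // lte_fin lee_fin; lia.
by apply/eqP/idP; rewrite -E => /(red_ker hred hx').
Qed.
Lemma red_neq0 x : vdvd v 0 x -> (red x != 0) <-> v x = 0%:E.
Proof. by move=> hx; rewrite red_eq0 // val_unitE. Qed.
Lemma red_eq x y : vdvd v 0 x -> vdvd v 0 y -> (red x == red y) = vdvd v 1 (x - y).
Proof.
move=> hx hy; rewrite -subr_eq0 -redN // -redD' ?(vdvdN hv) //.
by rewrite red_eq0 // (vdvdB hv).
Qed.

Definition lift_res (z : F) : K := projT1 (cid2 (red_surj hred z)).
Lemma lift_res_int z : vdvd v 0 (lift_res z).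
Proof. by rewrite /lift_res; case: cid2. Qed.
Lemma lift_resK z : red (lift_res z) = z.
Proof. by rewrite /lift_res; case: cid2. Qed.

End Residue.

(** Integer-valued like [eta], so that the two can be equated without a cast. *)
Definition quadratic_char (F : finFieldType) (z : F) : int :=
  if z == 0 then 0 else if [exists y, y ^+ 2 == z] then 1 else -1.

(** * Hensel's lemma for squares, and [eta] read off in the residue field *)

Section Hensel.
Variables (K : fieldType) (v : K -> \bar int).
Hypothesis hv : normalized_valuation v.
Hypothesis hcomplete : valuation_complete v.
Variables (F : finFieldType) (red : K -> F).
Hypothesis hred : residue_map v red.
Hypothesis h2 : v 2%:R = 0%:E.

(** Newton's iteration for X^2 - u, started at a lift of z. All iterates are units, so dividing by
    2x costs no precision. *)
Lemma hensel_sqrt u z : v u = 0%:E -> red u = z ^+ 2 ->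
  exists2 x, v x = 0%:E & u = x ^+ 2.
Proof.
move=> hu huz; pose nwt (x : K) : K := x - (x ^+ 2 - u) / (2%:R * x).
pose x n := iter n nwt (lift_res hred z).
have z0 : z != 0.
  apply/eqP => z0; have /(red_neq0 hred (unit_vdvd hu)) : v u = 0%:E by [].
  by rewrite huz z0 expr0n eqxx.
have hx n : v (x n) = 0%:E /\ vdvd v n.+1 (x n ^+ 2 - u).
  elim: n => [|n [IH1 IH2]].
    have hl := lift_res_int hred z; split.
      by apply/(red_neq0 hred) => //; rewrite lift_resK.
    rewrite /x /= -(red_eq hv hred) ?(vdvdX hv) ?(unit_vdvd hu) //.
    by rewrite (redX hv hred) // lift_resK huz.
  have h2x : v (2%:R * x n) = 0%:E by rewrite (nvM hv) h2 IH1 add0e.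
  have x0 := unit_neq0 hv IH1; have n20 := unit_neq0 hv h2.
  set d := (x n ^+ 2 - u) / (2%:R * x n).
  have hd : vdvd v n.+1 d.
    by rewrite /d mulrC (vdvd_unit hv) // vdvd_unitV.
  have Ex : x n.+1 = x n - d by [].
  split.
    have hd0 := vdvdW (leq0n _) hd; apply/(val_eq_nat v 0).
    rewrite Ex (vdvdB hv) ?(unit_vdvd IH1) //=.
    rewrite addrC (vdvdDr hv) ?(vdvdN hv); last exact: vdvdW hd.
    by apply/val_unitE => //; exact: unit_vdvd.
  (* The new error is exactly the square of the correction, so its valuation is at least 2(n+1);
     only the weaker n+2 is recorded. *)
  have -> : x n.+1 ^+ 2 - u = d * d.
    by rewrite Ex /d; field; rewrite x0.
  by apply: vdvdW (vdvdM hv hd hd); lia.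
have hstep m n : (n <= m)%N -> vdvd v n.+1 (x m - x n).
  elim: m => [|m IH]; first by rewrite leqn0 => /eqP ->; rewrite subrr (vdvd0 hv).
  rewrite leq_eqVlt => /predU1P[->|]; first by rewrite subrr (vdvd0 hv).
  rewrite ltnS => nm; rewrite -(subrK (x m) (x m.+1)) -addrA (vdvdD hv) ?IH //.
  rewrite [x m.+1]/(nwt (x m)) /nwt addrAC subrr add0r (vdvdN hv) mulrC.
  have [h1 h3] := hx m; rewrite (vdvd_unit hv); first by apply: vdvdW h3.
  by rewrite (vdvd_unitV hv) // (nvM hv) h2 h1 add0e.
have [N|l hl] := @hcomplete x.
  exists `|N|%N => m n hm hn; wlog nm : m n hm hn / (n <= m)%N.
    move=> H; case: (leqP n m) => h; first exact: H.
    by rewrite -opprB (valuationN hv); apply: H => //; exact: ltnW.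
  by apply: le_trans (hstep m n nm); rewrite lee_fin; lia.
have hlu : l ^+ 2 = u.
  apply/eqP; rewrite -subr_eq0; apply/eqP/(val_eq0 hv) => N.
  have [n0 hn0] := hl (Posz `|N|%N); pose n := maxn n0 `|N|%N.
  have hxl : vdvd v `|N| (x n - l) by apply: hn0; rewrite leq_maxl.
  have -> : l ^+ 2 - u = (x n - l) * (x n - l - 2%:R * x n) + (x n ^+ 2 - u) by ring.
  apply: (@le_trans _ _ (Posz `|N|%N)%:E); first by rewrite lee_fin; lia.
  have [h1 h3] := hx n.
  apply: (vdvdD hv); last by apply: vdvdW h3; rewrite /n; lia.
  apply: (vdvdMl hv) => //; apply: (vdvdB hv); first by apply: vdvdW hxl.
  by rewrite unit_vdvd // (nvM hv) h2 h1 add0e.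
exists l => //; have l0 : l != 0.
  by apply/eqP => l0; move: hu; rewrite -hlu l0 expr0n /= (valuation0 hv).
have [a Ea] := val_fin hv l0.
by move: hu; rewrite -hlu (valuationX hv _ Ea) => -[] e; rewrite Ea; congr _%:E; lia.
Qed.

(** A square root of a nonzero residue lifts by [hensel_sqrt], so a nonsquare unit has a nonsquare
    residue; a nonunit has residue 0 and both sides vanish. *)
Lemma eta_red x : vdvd v 0 x -> eta v x = quadratic_char (red x).
Proof.
move=> hx; rewrite /eta /quadratic_char; case: asboolP => [[u hu ->]|hn].
  have hu' := unit_vdvd hu.
  have ru : red u != 0 by apply/(red_neq0 hred).
  rewrite (redX hv hred) // sqrf_eq0 (negPf ru).
  by case: existsP => // -[]; exists (red u).
case: eqP => [/(red_neq0 hred hx)|hx0].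
  move=> h; rewrite (negPf h); case: existsP => // -[y /eqP Ey].
  by case: hn; apply: (@hensel_sqrt _ y) => //; exact/(red_neq0 hred).
by case: eqP => // /eqP /(red_neq0 hred hx).
Qed.

End Hensel.

(** * Completeness of a finite extension of a complete valued field *)

Section Completeness.
Variables (Qp : fieldType) (vp : Qp -> \bar int) (K : fieldExtType Qp).
Variables (v : K -> \bar int) (e : nat).
Hypothesis hvp : normalized_valuation vp.
Hypothesis hcomp : valuation_complete vp.
Hypothesis hv : normalized_valuation v.
Hypothesis e_gt0 : (0 < e)%N.
Hypothesis hext : forall x : Qp, v (x%:A) = (vp x *+ e)%E.

Definition cauchy_seq (k : fieldType) (nu : k -> \bar int) (u : nat -> k) :=
  forall N : int, exists n0 : nat, forall m n : nat,
    (n0 <= m)%N -> (n0 <= n)%N -> (N%:E <= nu (u m - u n)%R)%E.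
Definition limit_of (k : fieldType) (nu : k -> \bar int) (u : nat -> k) (l : k) :=
  forall N : int, exists n0 : nat, forall n : nat,
    (n0 <= n)%N -> (N%:E <= nu (u n - l)%R)%E.
Definition complete_in (U : {vspace K}) :=
  forall u, (forall n, u n \in U) -> cauchy_seq v u -> exists2 l, l \in U & limit_of v u l.

Lemma val_scale a x : v (a *: x) = (vp a *+ e + v x)%E.
Proof. by rewrite -mulr_algl (nvM hv) hext. Qed.

Lemma vp_fin a : a != 0 -> exists k : int, vp a = k%:E /\ (vp a *+ e)%E = (k * e%:Z)%:E.
Proof.
move=> /(val_fin hvp) [k Ek]; exists k; split => //.
by rewrite Ek -EFin_natmul -mulr_natr natz.
Qed.

(* A vector outside the complete space U has positive distance from U, so a
   Cauchy sequence in <[x]> + U has Cauchy components. *)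
Lemma complete_in_addv x U : complete_in U -> complete_in (<[x]> + U)%VS.
Proof.
move=> cU; case: (boolP (x \in U)) => xU.
  have -> // : (<[x]> + U)%VS = U by apply/addv_idPr; rewrite -memvE.
(* Otherwise x is a limit of vectors w n of U; these form a Cauchy sequence, and by completeness of
   U the limit x would lie in U. *)
have [N0 hN0] : exists N : int, forall w, w \in U -> (v (x - w)%R < N%:E)%E.
  apply: contrapT => /forallNP h.
  have h' (n : nat) : exists2 w, w \in U & ((n%:Z)%:E <= v (x - w)%R)%E.
    have := h n%:Z => /existsNP [w /not_implyP [wU /negP]]; rewrite -leNgt => ?.
    by exists w.
  pose w n := projT1 (cid2 (h' n)).
  have wU n : w n \in U by rewrite /w; case: cid2.
  have hw n : ((n%:Z)%:E <= v (x - w n)%R)%E by rewrite /w; case: cid2.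
  have [N|l lU hl] := cU w wU.
    exists `|N|%N => m n hm hn.
    have -> : w m - w n = (x - w n) - (x - w m) by ring.
    by apply: (val_ge_sub hv); (apply: le_trans (hw _); rewrite lee_fin; lia).
  have xl : x - l = 0.
    apply: (val_eq0 hv) => N; have [n0 hn0] := hl N.
    pose n := maxn n0 `|N|%N.
    have -> : x - l = (x - w n) + (w n - l) by ring.
    apply: (val_ge_add hv); last by apply: hn0; rewrite leq_maxl.
    by apply: le_trans (hw _); rewrite lee_fin /n; lia.
  by move: xU; rewrite -(subrK l x) xl add0r lU.
move=> y hy cy.
have hy' n : exists au : Qp * K, au.2 \in U /\ y n = au.1 *: x + au.2.
  have /memv_addP [s /vlineP [a ->] [u uU ->]] := hy n.
  by exists (a, u).
pose au n := projT1 (cid (hy' n)).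
pose a n := (au n).1; pose u n := (au n).2.
have hu n : u n \in U by rewrite /u /au; case: cid => ? [].
have Ey n : y n = a n *: x + u n by rewrite /a /u /au; case: cid => ? [].
(* Factoring b = a m - a n out of y m - y n leaves x minus a vector of U, of valuation below N0. A
   difference of valuation at least N e + N0 therefore forces vp b >= N. *)
have ca : cauchy_seq vp a.
  move=> N; have [n0 hn0] := cy (N * e%:Z + N0); exists n0 => m n hm hn.
  have := hn0 m n hm hn.
  set b := a m - a n; have [->|b0] := eqVneq b 0; first by rewrite (valuation0 hvp) leey.
  have -> : y m - y n = b *: (x - b^-1 *: (u n - u m)).
    rewrite scalerBr scalerA divff // scale1r !Ey /b scalerBl.
    by move: (a m *: x) (a n *: x) => A B; ring.
  rewrite val_scale; have [k [Ek ->]] := vp_fin b0; rewrite Ek lee_fin.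
  have := hN0 (b^-1 *: (u n - u m)) (rpredZ _ (rpredB (hu _) (hu _))).
  case: (v _) => [c| |] //; rewrite lte_fin -EFinD lee_fin => h1 h2; nia.
(* Continuity of b |-> b x at 0. The witness |N| + |c| is nonnegative, so multiplying a valuation
   above it by e >= 1 only helps. *)
have hax N : exists M : int, forall b, (M%:E <= vp b)%E -> (N%:E <= v (b *: x))%E.
  have [->|x0] := eqVneq x 0.
    by exists 0 => b _; rewrite scaler0 (valuation0 hv) leey.
  have [c Ec] := val_fin hv x0; exists (`|N| + `|c|)%R => b.
  have [->|b0] := eqVneq b 0; first by rewrite scale0r (valuation0 hv) leey.
  rewrite val_scale Ec; have [k [-> ->]] := vp_fin b0.
  rewrite -EFinD !lee_fin; nia.
have [al hal] := hcomp ca.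
have cu : cauchy_seq v u.
  move=> N; have [M hM] := hax N; have [n1 hn1] := ca M; have [n2 hn2] := cy N.
  exists (maxn n1 n2) => m n; rewrite !geq_max => /andP[m1 m2] /andP[k1 k2].
  have -> : u m - u n = (y m - y n) - (a m - a n) *: x.
    by rewrite !Ey scalerBl; move: (a m *: x) (a n *: x) => A B; ring.
  by apply: (val_ge_sub hv); [apply: hn2 | apply/hM/hn1].
have [ul ulU hul] := cU u hu cu.
exists (al *: x + ul).
  by apply/memv_addP; exists (al *: x); [exact/vlineP/ex_intro | exists ul].
move=> N; have [M hM] := hax N; have [n1 hn1] := hal M; have [n2 hn2] := hul N.
exists (maxn n1 n2) => n; rewrite !geq_max => /andP[m1 m2].
have -> : y n - (al *: x + ul) = (a n - al) *: x + (u n - ul).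
  by rewrite Ey scalerBl opprD addrACA.
by apply: (val_ge_add hv); [apply/hM/hn1 | apply: hn2].
Qed.

(** Induction along a basis: each new basis vector is adjoined by [complete_in_addv]. *)
Lemma complete_in_all U : complete_in U.
Proof.
rewrite -(span_basis (vbasisP U)); elim: (tval _) => [|x s IH]; last first.
  by rewrite span_cons; exact: complete_in_addv.
rewrite span_nil => u hu _; exists 0; rewrite ?mem0v // => N; exists 0%N => n _.
by have := hu n; rewrite memv0 => /eqP ->; rewrite subr0 (valuation0 hv) leey.
Qed.

Lemma fieldExt_complete : valuation_complete v.
Proof.
move=> u cu; have [|l _ hl] := @complete_in_all fullv u _ cu.
  by move=> n; exact: memvf.
by exists l.
Qed.

End Completeness.

Lemma padic_field_val2 p (Qp : fieldType) (vp : Qp -> \bar int) (K : fieldExtType Qp)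
  (v : K -> \bar int) : prime p -> odd p -> padic_field p vp v -> v 2%:R = 0%:E.
Proof.
move=> p_prime p_odd [hb hv [e e0 he]].
have -> : 2%:R = (2%:R : Qp)%:A :> K by rewrite scaler_nat.
rewrite he; have -> : 2%:R = ratr 2%:R :> Qp by rewrite (ratr_int Qp 2).
rewrite (Qp_extends hb) /padic_val.
have -> : (2%:R == 0 :> rat) = false by [].
rewrite (_ : numq 2%:R = 2) // (_ : denq 2%:R = 1) //=.
have -> : logn p 2 = 0%N.
  rewrite lognE p_prime /= dvdn_prime2 //; case: eqP => // p2.
  by rewrite p2 in p_odd.
by rewrite logn1 subrr -EFin_natmul mul0rn.
Qed.

Lemma padic_field_complete p (Qp : fieldType) (vp : Qp -> \bar int) (K : fieldExtType Qp)
  (v : K -> \bar int) : padic_field p vp v -> valuation_complete v.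
Proof.
move=> [hb hv [e e0 he]].
exact: (fieldExt_complete (Qp_valuation hb) (Qp_complete hb) hv e0 he).
Qed.

(** * Diagonal quadratic equations over a finite field *)

Section QuadraticCharacter.
Variable F : finFieldType.
Hypothesis h2 : 2%:R != 0 :> F.
Local Notation chi := (@quadratic_char F).

Lemma chi0 : chi 0 = 0. Proof. by rewrite /quadratic_char eqxx. Qed.
Lemma chi_sqr x : x != 0 -> chi (x ^+ 2) = 1.
Proof.
move=> x0; rewrite /quadratic_char sqrf_eq0 (negPf x0).
by case: existsP => // -[]; exists x.
Qed.
Lemma chi1 : chi 1 = 1.
Proof. by rewrite -(expr1n _ 2) chi_sqr ?oner_eq0. Qed.

Lemma chi_cases x : x != 0 -> chi x = 1 \/ chi x = -1.
Proof.
by rewrite /quadratic_char => /negPf ->; case: ifP; [left | right].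
Qed.

Lemma unit_generator : exists g : F, forall x, x != 0 -> exists i, x = g ^+ i.
Proof.
have /cyclicP [g Eg] := field_unit_group_cyclic [set: {unit F}].
exists (val g) => x; rewrite -unitfE => hx.
have : FinRing.unit F hx \in <[g]>%g by rewrite -Eg inE.
case/cycleP => i Ei; exists i.
by have := congr1 val Ei; rewrite /= FinRing.val_unitX.
Qed.

Lemma chi_sqrM x y : y != 0 -> chi (x * y ^+ 2) = chi x.
Proof.
move=> y0; rewrite /quadratic_char mulf_eq0 sqrf_eq0 (negPf y0) orbF.
case: eqP => // _; congr (if _ then _ else _); apply/existsP/existsP.
  move=> [z /eqP Ez]; exists (z / y); apply/eqP.
  by rewrite expr_div_n Ez mulfK // sqrf_eq0.
by move=> [z /eqP Ez]; exists (z * y); rewrite exprMn Ez.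
Qed.

(** A square factor is absorbed by [chi_sqrM]. Two nonsquares are odd powers of a generator of the
    cyclic group of units, so their product is an even power. *)
Lemma chiM x y : chi (x * y) = chi x * chi y.
Proof.
have [->|x0] := eqVneq x 0; first by rewrite mul0r chi0 mul0r.
have [->|y0] := eqVneq y 0; first by rewrite mulr0 chi0 mulr0.
have sq z : z != 0 -> chi z = 1 -> exists2 s, z = s ^+ 2 & s != 0.
  move=> z0; rewrite /quadratic_char (negPf z0); case: existsP => // -[s /eqP Es] _.
  by exists s => //; rewrite -sqrf_eq0 Es.
case: (chi_cases y0) => Ey.
  by have [s -> s0] := sq _ y0 Ey; rewrite chi_sqrM // chi_sqr // mulr1.
case: (chi_cases x0) => Ex.
  by have [s -> s0] := sq _ x0 Ex; rewrite mulrC chi_sqrM // chi_sqr // mul1r.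
have [g hg] := unit_generator.
have oddg z : z != 0 -> chi z = -1 -> exists k, z = g ^+ (k.*2).+1.
  move=> z0 Ez; have [i Ei] := hg _ z0; exists i./2.
  rewrite Ei -[in LHS](odd_double_half i); case: (boolP (odd i)) => // io.
  move: Ez; rewrite Ei -(odd_double_half i) (negPf io) add0n -muln2 exprM chi_sqr //.
  apply: contra_neq z0 => gi; rewrite Ei -(odd_double_half i) (negPf io) add0n.
  by rewrite -muln2 exprM gi expr0n.
have [i Ei] := oddg _ x0 Ex; have [j Ej] := oddg _ y0 Ey.
have E : x * y = (g ^+ (i + j).+1) ^+ 2.
  by rewrite Ei Ej -exprD -exprM; congr (_ ^+ _); lia.
rewrite Ex Ey E chi_sqr //.
by have := mulf_neq0 x0 y0; rewrite E sqrf_eq0.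
Qed.

Lemma chiV_mul a b : a != 0 -> chi (b / a) = chi (a * b).
Proof.
by move=> a0; rewrite -(chi_sqrM (b / a) a0); congr chi; field.
Qed.

Lemma card_sqrt z : \sum_(y : F) (y ^+ 2 == z)%:R = 1 + chi z :> int.
Proof.
rewrite (eq_bigr (fun y => if y ^+ 2 == z then 1 else 0)); last by move=> y _; case: (_ == _).
rewrite -big_mkcond /quadratic_char /=.
have [->|z0] := eqVneq z 0.
  rewrite (eq_bigl (pred1 0)) ?big_pred1_eq // => y.
  by rewrite sqrf_eq0.
case: existsP => [[s /eqP Es]|hn]; last first.
  by rewrite big1 // => y /eqP Ey; case: hn; exists y; apply/eqP.
have s0 : s != 0 by rewrite -sqrf_eq0 Es.
rewrite (bigD1 s) ?Es //= (bigD1 (- s)) /=; last first.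
  rewrite sqrrN Es eqxx /= -subr_eq0 -opprD oppr_eq0 -mulr2n -mulr_natl.
  by rewrite mulf_neq0.
rewrite big1 // => y /andP[/andP[/eqP Ey ys] yNs].
by have := eqf_sqr y s; rewrite Ey Es eqxx (negPf ys) (negPf yNs).
Qed.

Lemma sum_int_const (c : int) : \sum_(y : F) c = #|F|%:R * c.
Proof. by rewrite sumr_const mulr_natl. Qed.

Lemma sum_ind (c : F) : \sum_(y : F) (y == c)%:R = 1 :> int.
Proof.
rewrite (bigD1 c) //= eqxx big1 ?addr0 // => y /negPf ->; by [].
Qed.

(* For c != 0 this counts the points of the hyperbola (y - x) (y + x) = c. *)
Lemma jacobi_sum c : \sum_(y : F) chi (y ^+ 2 - c) = #|F|%:R * (c == 0)%:R - 1.
Proof.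
have [->|c0] := eqVneq c 0.
  rewrite (bigD1 0) //= expr0n subr0 chi0 add0r (eq_bigr (fun=> 1)); last first.
    by move=> y y0; rewrite subr0 chi_sqr.
  have := sum_int_const 1; rewrite (bigD1 0) //= !mulr1 => <-.
  by rewrite addrAC subrr add0r.
(* Adding 1 turns the character into the number of square roots of y^2 - c, so the sum counts pairs.
   Since 2 is invertible, half-sums and half-differences are coordinates, and the count becomes that
   of xy = c. *)
suff : \sum_(y : F) (1 + chi (y ^+ 2 - c)) = #|F|%:R - 1.
  rewrite big_split /= sum_int_const !mulr1 mulr0 => /addrI ->; by rewrite add0r.
under eq_bigr do rewrite -card_sqrt.
rewrite (pair_bigA _ (fun y x : F => (x ^+ 2 == y ^+ 2 - c)%:R)) /=.
rewrite (reindex (fun p : F * F => ((p.1 + p.2) / 2%:R, (p.1 - p.2) / 2%:R))) /=; last first.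
  exists (fun p : F * F => (p.1 + p.2, p.1 - p.2)) => -[x y] _ /=; congr pair; by field.
rewrite (eq_bigr (fun p : F * F => (p.1 * p.2 == c)%:R)); last first.
  move=> [x y] _ /=; congr (_%:R); congr nat_of_bool.
  rewrite -[LHS]subr_eq0 -[RHS]subr_eq0; rewrite -[RHS]oppr_eq0.
  congr (_ == 0); by field.
rewrite -(pair_bigA _ (fun x y : F => (x * y == c)%:R)) /= (bigD1 0) //=.
rewrite big1 ?add0r; last by move=> y _; rewrite mul0r eq_sym (negPf c0).
rewrite (eq_bigr (fun=> 1)); last first.
  move=> x x0; apply: (etrans _ (sum_ind (c / x))); apply: eq_bigr => y _.
  by rewrite (can2_eq (mulKf x0) (mulVKf x0)) mulrC.
have := sum_int_const 1; rewrite (bigD1 0) //= !mulr1 => <-.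
by rewrite addrAC subrr add0r.
Qed.

Variable C : numFieldType.
Local Notation q := (#|F|%:R : C).
Local Notation chiC := (fun z : F => (quadratic_char z)%:~R : C).

Lemma card_neq0 : q != 0.
Proof. by rewrite pnatr_eq0 -lt0n; apply/card_gt0P; exists 0. Qed.

(* Zero coefficients are allowed; they do not contribute to the rank and the
   discriminant below. *)
Definition quad_density n (alpha : 'I_n -> F) (b : F) : C :=
  (\sum_(z : 'rV[F]_n) (\sum_i alpha i * z 0 i ^+ 2 == b)%:R) / q ^+ n.

Definition diag_rank n (alpha : 'I_n -> F) : nat := (\sum_i nat_of_bool (alpha i != 0%R))%N.
Definition diag_disc n (alpha : 'I_n -> F) : F := \prod_(i | alpha i != 0) alpha i.

(** The classical proportion of solutions of a nondegenerate quadratic equation of rank r: main term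
    1/q and a correction by the quadratic character. For r = 0 and d = 1 it reduces to the indicator
    of b = 0. *)
Definition quad_density_formula (r : nat) (d b : F) : C :=
  if odd r then q^-1 + chiC b * chiC ((-1) ^+ r./2 * d) / q ^+ r./2.+1
  else q^-1 + chiC ((-1) ^+ r./2 * d) / q ^+ r./2 * ((b == 0)%:R - q^-1).

Lemma sum_rowS (V : nmodType) n (E : 'rV[F]_(1 + n) -> V) :
  \sum_z E z = \sum_(y : F) \sum_(z : 'rV[F]_n) E (row_mx (y%:M) z).
Proof.
rewrite pair_bigA /= (reindex (fun p : F * 'rV_n => row_mx (p.1%:M) p.2)) //=.
exists (fun z : 'rV_(1 + n) => (lsubmx z 0 0, rsubmx z)) => [[y z]|z] _ /=.
  by rewrite row_mxKl row_mxKr mxE eqxx mulr1n.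
by rewrite -mx11_scalar hsubmxK.
Qed.

Lemma quad_densityS n (alpha : 'I_(1 + n) -> F) b :
  quad_density alpha b =
  (\sum_(y : F) quad_density (fun i => alpha (rshift 1 i))
                  (b - alpha (lshift n 0) * y ^+ 2)) / q.
Proof.
rewrite /quad_density sum_rowS -mulr_suml [q ^+ (1 + n)]exprSr invfM mulrA.
congr (_ / _ / _); apply: eq_bigr => y _; apply: eq_bigr => z _.
congr (_%:R); congr nat_of_bool.
rewrite big_split_ord /= big_ord1 row_mxEl mxE eqxx mulr1n.
rewrite (eq_bigr (fun i => alpha (rshift 1 i) * z 0 i ^+ 2)); last first.
  by move=> i _; rewrite row_mxEr.
by rewrite [in RHS]eq_sym subr_eq eq_sym addrC.
Qed.

Lemma sum_chiC_sub a b : a != 0 ->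
  \sum_(y : F) chiC (b - a * y ^+ 2) = chiC (- a) * (q * (b == 0)%:R - 1).
Proof.
move=> a0; transitivity ((\sum_(y : F) (chi (- a) * chi (y ^+ 2 - b / a)))%:~R : C).
  rewrite rmorph_sum; apply: eq_bigr => y _ /=; rewrite -chiM; congr (chi _)%:~R.
  by field.
rewrite -mulr_sumr jacobi_sum mulf_eq0 invr_eq0 (negPf a0) orbF.
by rewrite !(rmorphM, rmorphB, rmorph_nat, rmorph1) /=.
Qed.

Lemma sum_ind_sqr a b : a != 0 ->
  \sum_(y : F) (b - a * y ^+ 2 == 0)%:R = 1 + chiC (a * b) :> C.
Proof.
move=> a0; transitivity ((\sum_(y : F) (y ^+ 2 == b / a)%:R : int)%:~R : C).
  rewrite rmorph_sum; apply: eq_bigr => y _ /=; rewrite rmorph_nat; congr (_%:R).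
  congr nat_of_bool; rewrite subr_eq0 eq_sym.
  by apply/eqP/eqP => [<-|->]; field.
by rewrite card_sqrt chiV_mul // rmorphD rmorph1.
Qed.

Lemma diag_rankS n (alpha : 'I_(1 + n) -> F) :
  diag_rank alpha = ((alpha (lshift n ord0) != 0%R) + diag_rank (fun i => alpha (rshift 1 i)))%N.
Proof. by rewrite /diag_rank big_split_ord big_ord1. Qed.

Lemma diag_discS n (alpha : 'I_(1 + n) -> F) :
  diag_disc alpha = (if alpha (lshift n ord0) != 0 then alpha (lshift n ord0) else 1)
                    * diag_disc (fun i => alpha (rshift 1 i)).
Proof. by rewrite /diag_disc big_split_ord /= [X in X * _]big_mkcond big_ord1. Qed.

(** Induction on the number of variables, fixing the first coordinate y, which replaces b by b - a
    y^2. A zero coefficient leaves the density unchanged. *)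
Lemma quad_densityE n (alpha : 'I_n -> F) b :
  quad_density alpha b = quad_density_formula (diag_rank alpha) (diag_disc alpha) b.
Proof.
have q0 := card_neq0.
have sumc (c : C) : \sum_(y : F) c = q * c by rewrite sumr_const mulr_natl.
elim: n alpha b => [|n IH] alpha b.
  rewrite /quad_density /diag_rank /diag_disc !big_ord0 /quad_density_formula /=.
  rewrite ?expr0 ?mul1r chi1 ?expr0 !divr1 mul1r addrC subrK.
  rewrite (big_pred1 0); last by move=> z; rewrite !thinmx0; apply/esym/eqP.
  by rewrite big_ord0 eq_sym.
rewrite (@quad_densityS n) (@diag_rankS n) (@diag_discS n).
set a := alpha (@lshift 1 n ord0); pose beta (i : 'I_n) := alpha (@rshift 1 n i).
rewrite -/beta.
under eq_bigr do rewrite IH.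
have [->|a0] /= := eqVneq a 0.
  rewrite mul1r (eq_bigr (fun=> quad_density_formula (diag_rank beta) (diag_disc beta) b)); last first.
    by move=> y _; rewrite mul0r subr0.
  by rewrite sumc; field.
rewrite /quad_density_formula add1n /=; set r := diag_rank beta; set d := diag_disc beta.
(* From odd to even rank the character of b - a y^2 is summed, which is the Jacobi sum; from even to
   odd rank the indicator of b = a y^2 is summed, which is a count of square roots. *)
case: (boolP (odd r)) => ro /=.
  rewrite big_split /= sumc -!mulr_suml sum_chiC_sub //.
  have -> : uphalf r = r./2.+1 by rewrite uphalf_half ro.
  have -> : chiC ((-1) ^+ r./2.+1 * (a * d)) = chiC (- a) * chiC ((-1) ^+ r./2 * d).
    by rewrite -intrM -chiM; congr (chi _)%:~R; rewrite exprS; ring.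
  by rewrite !exprS; field; rewrite q0 expf_neq0.
have -> : uphalf r = r./2 by rewrite uphalf_half (negPf ro).
rewrite big_split /= sumc -!mulr_sumr big_split /= sum_ind_sqr // sumc.
have -> : chiC (a * b) = chiC a * chiC b by rewrite chiM intrM.
have -> : chiC ((-1) ^+ r./2 * (a * d)) = chiC a * chiC ((-1) ^+ r./2 * d).
  by rewrite -intrM -chiM; congr (chi _)%:~R; ring.
by rewrite !exprS; field; rewrite q0 expf_neq0.
Qed.

(** Each coordinate with a nonzero coefficient is forced to be 0 and costs a factor q; the others
    are free. *)
Lemma null_density n (alpha : 'I_n -> F) :
  (\sum_(z : 'rV[F]_n) ([forall i, (alpha i != 0) ==> (z 0 i == 0)])%:R) / q ^+ n
  = (q ^+ diag_rank alpha)^-1.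
Proof.
have q0 := card_neq0; elim: n alpha => [|n IH] alpha.
  rewrite /diag_rank big_ord0 !expr0 (big_pred1 0) ?divr1 ?invr1.
    by case: forallP => // -[] [].
  by move=> z; rewrite !thinmx0; apply/esym/eqP.
rewrite (@sum_rowS C n) (@diag_rankS n).
set a := alpha (@lshift 1 n ord0); pose beta (i : 'I_n) := alpha (@rshift 1 n i).
rewrite -/beta exprD invfM -IH.
have E (y : F) z : [forall i, (alpha i != 0) ==> (row_mx (y%:M : 'M[F]_1) z 0 i == 0)] =
    ((a != 0) ==> (y == 0)) && [forall i, (beta i != 0) ==> (z 0 i == 0)].
  apply/forallP/andP => [h|[h1 /forallP h2'] i].
    split; first by have := h (@lshift 1 n ord0); rewrite row_mxEl mxE eqxx mulr1n.
    by apply/forallP => i; have := h (@rshift 1 n i); rewrite row_mxEr.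
  case: (@splitP 1 n i) => j Ej.
    have -> : i = @lshift 1 n ord0 by apply: val_inj; rewrite /= Ej ord1.
    by rewrite row_mxEl mxE eqxx mulr1n.
  have -> : i = @rshift 1 n j by apply: val_inj; rewrite /= Ej.
  by rewrite row_mxEr; exact: h2'.
under eq_bigr do under eq_bigr do rewrite E -mulnb natrM.
under eq_bigr do rewrite -mulr_sumr.
rewrite -mulr_suml exprS.
have -> : \sum_(y : F) ((a != 0) ==> (y == 0))%:R = if a == 0 then q else 1 :> C.
  have [_|_] := eqVneq a 0; first by rewrite sumr_const.
  by rewrite (bigD1 0) //= eqxx big1 ?addr0 // => y /negPf ->.
case: eqP => _ /=; rewrite ?expr0 ?expr1; by field; rewrite ?q0 ?expf_neq0.
Qed.

End QuadraticCharacter.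

(** * Diagonalisation of unimodular forms *)

Section Diagonalisation.
Variables (K : fieldType) (v : K -> \bar int).
Hypothesis hv : normalized_valuation v.
Hypothesis h2 : v 2%:R = 0%:E.

Definition imx m n (A : 'M[K]_(m, n)) := forall i j, vdvd v 0 (A i j).

Lemma imxM m n p (A : 'M[K]_(m, n)) (B : 'M[K]_(n, p)) : imx A -> imx B -> imx (A *m B).
Proof.
by move=> hA hB i j; rewrite mxE; apply: (vdvd_sum hv) => k _; rewrite (vdvdMl hv).
Qed.
Lemma imxT m n (A : 'M[K]_(m, n)) : imx A -> imx A^T.
Proof. by move=> hA i j; rewrite mxE. Qed.
Lemma imx_scalar n a : vdvd v 0 a -> imx (a%:M : 'M[K]_n).
Proof. by move=> ha i j; rewrite mxE; case: eqP => // _; exact: vdvd0. Qed.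
Lemma imx1 n : imx (1%:M : 'M[K]_n).
Proof. exact/imx_scalar/vdvd1. Qed.
Lemma imx0 m n : imx (0 : 'M[K]_(m, n)).
Proof. by move=> i j; rewrite mxE; exact: vdvd0. Qed.
Lemma imx_block m1 m2 n1 n2 (A : 'M[K]_(m1, n1)) (B : 'M[K]_(m1, n2))
  (C : 'M[K]_(m2, n1)) (D : 'M[K]_(m2, n2)) :
  imx A -> imx B -> imx C -> imx D -> imx (block_mx A B C D).
Proof.
move=> hA hB hC hD i j; rewrite !mxE; case: splitP => k _; rewrite mxE;
by case: splitP => l _.
Qed.
Lemma imx_det n (A : 'M[K]_n) : imx A -> vdvd v 0 (\det A).
Proof.
move=> hA; apply: (vdvd_sum hv) => s _; apply: (vdvdMl hv).
  by apply: (vdvdX hv); rewrite (vdvdN hv) (vdvd1 hv).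
by elim/big_ind: _ => // [|x y]; [exact: vdvd1 | exact: vdvdMl].
Qed.

Lemma unit_add_nonunit x y : v x = 0%:E -> vdvd v 1 y -> v (x + y) = 0%:E.
Proof.
move=> hx hy; have hy0 := vdvdW (leq0n _) hy; have hx0 := unit_vdvd hx.
apply/(val_unitE (vdvdD hv hx0 hy0)); rewrite addrC (vdvdDr hv) //.
exact/val_unitE.
Qed.

Lemma delta_mulE m n p (i : 'I_m) (j : 'I_n) (A : 'M[K]_(n, p)) k l :
  (delta_mx i j *m A) k l = (k == i)%:R * A j l.
Proof.
rewrite mxE (bigD1 j) //= big1 ?addr0 => [|a /negPf aj]; rewrite mxE ?eqxx ?andbT //.
by rewrite aj andbF mul0r.
Qed.

Lemma mul_deltaE m n p (i : 'I_n) (j : 'I_p) (A : 'M[K]_(m, n)) k l :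
  (A *m delta_mx i j) k l = A k i * (l == j)%:R.
Proof.
rewrite mxE (bigD1 i) //= big1 ?addr0 => [|a /negPf ai]; rewrite mxE ?eqxx //.
by rewrite ai mulr0.
Qed.

(* If M 0 j is a unit, one of the vectors e_0, e_0 + e_j, e_0 - e_j has unit
   norm. *)
Lemma unit_pivot n (M : 'M[K]_(n.+1)) : M^T = M -> imx M -> v (\det M) = 0%:E ->
  exists P P' : 'M[K]_(n.+1),
    [/\ imx P, imx P', P *m P' = 1%:M & v ((P *m M *m P^T) 0 0) = 0%:E].
Proof.
move=> symM hM dM.
(* If the first row had no unit, expanding the determinant along it would give a nonunit. *)
have [j hj] : exists j, v (M 0 j) = 0%:E.
  apply: contrapT => /forallNP h; suff : vdvd v 1 (\det M).
    by apply/negP/val_unitE => //; exact: unit_vdvd.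
  rewrite (expand_det_row M 0); apply: (vdvd_sum hv) => k _; apply: (vdvdMl hv).
    by apply: contrapT => /negP /(val_unitE (hM _ _)) /(h k).
  rewrite /cofactor; apply: (vdvdMl hv).
    by apply: (vdvdX hv); rewrite (vdvdN hv) (vdvd1 hv).
  by apply: imx_det => a b; rewrite !mxE.
have Mj0 : M j 0 = M 0 j by rewrite -[in LHS]symM mxE.
have [h00|h00] := boolP (vdvd v 1 (M 0 0)); last first.
  exists 1%:M, 1%:M; split; rewrite ?mulmx1 ?trmx1 ?mul1mx ?mulmx1 //; try exact: imx1.
  exact/(val_unitE (hM _ _)).
have j0 : j != 0.
  by apply/eqP => j0; move: hj; rewrite j0 => /(val_unitE (hM _ _)); rewrite h00.
have djj : delta_mx 0 j *m delta_mx 0 j = 0 :> 'M[K]_(n.+1).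
  by apply/matrixP => a b; rewrite delta_mulE !mxE (negPf j0) mulr0.
(* P replaces e_0 by e_0 + c e_j. The elementary matrix squares to 0 as j != 0, so changing the sign
   of c inverts P. *)
have P_ok c : vdvd v 0 c -> let P := 1%:M + c *: delta_mx 0 j in
   let P' := 1%:M - c *: delta_mx 0 j in
   [/\ imx P, imx P', P *m P' = 1%:M &
       (P *m M *m P^T) 0 0 = M 0 0 + (2%:R * c * M 0 j + c ^+ 2 * M j j)].
  move=> hc /=; split.
  - by move=> a b; rewrite !mxE (vdvdD hv) ?(vdvdMl hv) ?(vdvd_nat hv).
  - by move=> a b; rewrite !mxE (vdvdB hv) ?(vdvdMl hv) ?(vdvd_nat hv).
  - rewrite mulmxBr mulmx1 mulmxDl mul1mx -scalemxAl -scalemxAr djj.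
    by rewrite !scaler0 addr0 addrK.
  - rewrite linearD /= linearZ /= trmx1 trmx_delta mulmxDr mulmx1 -scalemxAr.
    rewrite mulmxDl mul1mx -scalemxAl.
    have EB l : (M + c *: (delta_mx 0 j *m M)) 0 l = M 0 l + c * M j l.
      by rewrite mxE [X in _ + X]mxE delta_mulE eqxx mul1r.
    by rewrite mxE [X in _ + X]mxE mul_deltaE eqxx mulr1 !EB Mj0; ring.
have hjj : exists2 c, vdvd v 0 c & v (2%:R * c * M 0 j + c ^+ 2 * M j j) = 0%:E.
  have h1 := vdvd1 hv.
  have iX c : vdvd v 0 c -> vdvd v 0 (2%:R * c * M 0 j + c ^+ 2 * M j j).
    by move=> hc; rewrite (vdvdD hv) // !(vdvdMl hv) ?(vdvdX hv) ?(vdvd_nat hv).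
  have [hu|hu] := boolP (vdvd v 1 (2%:R * M 0 j + M j j)); last first.
    exists 1 => //; apply/(val_unitE (iX _ h1)).
    by rewrite mulr1 expr1n mul1r.
  exists (-1); first by rewrite (vdvdN hv).
  (* The values at c = 1 and c = -1 differ by the unit 4 M 0 j, so they cannot both be nonunits. *)
  have -> : 2%:R * -1 * M 0 j + (-1) ^+ 2 * M j j =
     - (2%:R * 2%:R * M 0 j) + (2%:R * M 0 j + M j j) by ring.
  by apply: unit_add_nonunit => //; rewrite (valuationN hv) !(nvM hv) h2 hj !add0e.
have [c hc hcu] := hjj; have [iP iP' PP' E] := P_ok c hc.
exists (1%:M + c *: delta_mx 0 j), (1%:M - c *: delta_mx 0 j); split => //.
by rewrite E addrC; apply: unit_add_nonunit.
Qed.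

(** Symmetric Gaussian elimination over the valuation ring: a unit pivot can be split off without
    leaving the ring, and the complement is again unimodular. The integral inverse P' shows that P
    preserves the lattice of integral points. *)
Lemma unimodular_diag r (M : 'M[K]_r) : M^T = M -> imx M -> v (\det M) = 0%:E ->
  exists (P P' : 'M[K]_r) (u : 'rV[K]_r),
    [/\ imx P, imx P', P *m P' = 1%:M, P *m M *m P^T = diag_mx u
      & forall i, v (u 0 i) = 0%:E].
Proof.
elim: r M => [|r IH] M symM iM dM.
  exists 0, 0, 0; split; try (by move=> []); by rewrite [LHS]flatmx0 [RHS]flatmx0.
have [P1 [P1' [iP1 iP1' PP1 hu]]] := unit_pivot symM iM dM.
set N := P1 *m M *m P1^T; pose a := N 0 0.
have {}hu : v a = 0%:E by [].
have a0 := unit_neq0 hv hu.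
have symN : N^T = N by rewrite /N !trmx_mul trmxK symM mulmxA.
have iN : imx N by exact: imxM (imxM iP1 iM) (imxT iP1).
have unitdet P P' : imx P -> imx P' -> P *m P' = 1%:M :> 'M[K]_r.+1 -> v (\det P) = 0%:E.
  move=> iP iP' /(congr1 determinant); rewrite det_mulmx det1 => e.
  apply/(val_unitE (imx_det iP))/negP => h.
  have h1 : ~~ vdvd v 1 1 by apply/(val_unitE (vdvd1 hv)); rewrite (valuation1 hv).
  by case/negP: h1; rewrite -e; exact/(vdvdMl hv)/imx_det.
have dN : v (\det N) = 0%:E.
  by rewrite !det_mulmx det_tr !(nvM hv) dM (unitdet _ _ iP1 iP1' PP1) !add0e.
pose N' : 'M[K]_(1 + r) := N.
pose b : 'M[K]_(r, 1) := dlsubmx N'.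
have Nur : ursubmx N' = b^T by rewrite /b trmx_dlsub /N' symN.
have EN : N' = block_mx a%:M b^T b (drsubmx N').
  rewrite -Nur -[LHS]submxK; congr (block_mx _ _ _ _).
  rewrite [LHS]mx11_scalar; congr (_%:M).
  by rewrite [LHS]mxE [LHS]mxE /a /N'; congr (fun_of_matrix N _ _); apply: val_inj.
have ib : imx b by move=> i j; rewrite mxE mxE; exact: iN.
have iD : imx (drsubmx N') by move=> i j; rewrite mxE mxE; exact: iN.
have hai := vdvd_unitV hv hu.
pose E : 'M[K]_(1 + r) := block_mx 1%:M 0 (- a^-1 *: b) 1%:M.
pose E' : 'M[K]_(1 + r) := block_mx 1%:M 0 (a^-1 *: b) 1%:M.
have iE : imx E.
  apply: imx_block; [exact: imx1|exact: imx0| |exact: imx1].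
  by move=> i j; rewrite mxE mulNr (vdvdN hv) (vdvdMl hv) // unit_vdvd.
have iE' : imx E'.
  apply: imx_block; [exact: imx1|exact: imx0| |exact: imx1].
  by move=> i j; rewrite mxE (vdvdMl hv) // unit_vdvd.
have EE' : E *m E' = 1%:M.
  rewrite /E /E' mulmx_block !mul1mx !mul0mx !mulmx1 !mulmx0 addr0 add0r.
  by rewrite !add0r scaleNr addNr -scalar_mx_block.
(* The Schur complement of the pivot a. Its determinant is that of N divided by a, up to the square
   of a unit, hence a unit. *)
pose D := drsubmx N' - a^-1 *: (b *m b^T).
have ED : E *m N' *m E^T = block_mx a%:M 0 0 D.
  rewrite {1}EN /E tr_block_mx mulmx_block !mul1mx !mul0mx !addr0 trmx0 !trmx1.
  rewrite mulmx_block !mulmx0 !mulmx1 !addr0 linearZ /= mul_scalar_mx.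
  rewrite scalerA mulrN divff // scaleN1r addNr.
  rewrite -!scalemxAl mul_mx_scalar scalerA mulNr mulVf // scaleN1r addNr mul0mx add0r.
  by congr block_mx; rewrite /D scaleNr addrC.
have symD : D^T = D.
  rewrite /D linearB /= linearZ /= trmx_mul trmxK; congr (_ - _).
  by rewrite trmx_drsub /N' symN.
have iDD : imx D.
  move=> i j; rewrite mxE; apply: (vdvdD hv); first exact: iD.
  rewrite mxE (vdvdN hv) mxE; apply: (vdvdMl hv); first exact: unit_vdvd.
  by apply: imxM => //; exact: imxT.
have dD : v (\det D) = 0%:E.
  have := congr1 determinant ED.
  rewrite (det_mulmx (E *m N') E^T) (det_mulmx E N') det_tr det_ublock det_scalar1.
  move/(congr1 v); rewrite !(nvM hv) (unitdet _ _ iE iE' EE') hu (dN : v (\det N') = _) !add0e.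
  by move=> <-.
have [P2 [P2' [u [iP2 iP2' PP2 EDu hu2]]]] := IH D symD iDD dD.
pose G : 'M[K]_(1 + r) := block_mx 1%:M 0 0 P2.
pose G' : 'M[K]_(1 + r) := block_mx 1%:M 0 0 P2'.
have iG : imx G by apply: imx_block => //; do ?[exact: imx1|exact: imx0].
have iG' : imx G' by apply: imx_block => //; do ?[exact: imx1|exact: imx0].
have GG' : G *m G' = 1%:M.
  rewrite /G /G' mulmx_block !mulmx1 !mulmx0 !mul0mx !addr0 add0r PP2.
  by rewrite -scalar_mx_block.
have EG : G *m block_mx a%:M 0 0 D *m G^T = diag_mx (row_mx (a%:M : 'M[K]_1) u).
  rewrite /G tr_block_mx !trmx0 trmx1 !mulmx_block.
  rewrite !mul1mx !mulmx1 !mul0mx !mulmx0 !addr0 !add0r !mul0mx EDu diag_mx_row.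
  by congr block_mx; apply/matrixP => i j; rewrite !ord1 !mxE eqxx.
exists (G *m E *m P1), (P1' *m E' *m G'), (row_mx (a%:M : 'M[K]_1) u); split.
- exact: imxM (imxM iG iE) iP1.
- exact: imxM (imxM iP1' iE') iG'.
- rewrite !mulmxA -(mulmxA _ P1 P1') PP1 mulmx1 -(mulmxA _ E E') EE' mulmx1.
  exact: GG'.
- rewrite !trmx_mul !mulmxA.
  have -> : G *m E *m P1 *m M *m P1^T *m E^T *m G^T = G *m (E *m N' *m E^T) *m G^T.
    by rewrite /N' /N !mulmxA.
  by rewrite ED; exact: EG.
- move=> i; case: (@splitP 1 r i) => j Ej.
    have -> : i = @lshift 1 r j by exact: val_inj.
    by rewrite (@row_mxEl _ _ 1 r) mxE ord1 eqxx mulr1n.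
  have -> : i = @rshift 1 r j by exact: val_inj.
  by rewrite (@row_mxEr _ _ 1 r).
Qed.

End Diagonalisation.

(** * Translation-invariant measures *)

Section LocallyConstant.
Variables (K : fieldType) (v : K -> \bar int).
Hypothesis hv : normalized_valuation v.
Variable n : nat.
Local Notation X := 'rV[K]_n.

Definition vcong (k : nat) (x y : X) := forall j, vdvd v k (y 0 j - x 0 j).
(** Unions of classes modulo vectors of valuation at least k. They are open, which is how
    measurability is obtained below, and the explicit k tells which translations preserve them. *)
Definition locset (k : nat) (A : set X) := forall x y, vcong k x y -> A x -> A y.

Lemma vcongW j k x y : (j <= k)%N -> vcong k x y -> vcong j x y.
Proof. by move=> jk h i; apply: vdvdW (h i). Qed.
Lemma vcong_sym k x y : vcong k x y -> vcong k y x.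
Proof. by move=> h i; rewrite -opprB (vdvdN hv). Qed.

Lemma locsetW j k A : (j <= k)%N -> locset j A -> locset k A.
Proof. by move=> jk h x y /(vcongW jk); exact: h. Qed.
Lemma locsetI k A B : locset k A -> locset k B -> locset k (A `&` B).
Proof. by move=> hA hB x y h [Ax Bx]; split; [exact: hA h Ax | exact: hB h Bx]. Qed.

Lemma locset_measurable k A : locset k A -> measurable (A : set (borel_affine v n)).
Proof.
by move=> hA; apply: sub_sigma_algebra => x Ax; exists k%:Z => y h; exact: hA h Ax.
Qed.

Definition intset : set X := int_points v n.
Lemma locset_int : locset 0 intset.
Proof.
by move=> x y h hx j; rewrite -vdvd_int -(subrK (x 0 j) (y 0 j)) (vdvdD hv) //; exact: hx.
Qed.

(** Affine maps are continuous. T need not be integral, since division of coordinates by pi must be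
    covered; a common lower bound -C for the valuations of its entries costs C digits of
    precision. *)
Lemma linear_measurable (T : 'M[K]_n) (a : X) :
  measurable_fun setT (fun x : borel_affine v n => (x : X) *m T + a : borel_affine v n).
Proof.
apply: measurability; first by [].
move=> _ [U hU <-]; rewrite setTI; apply: sub_sigma_algebra => x /= hx.
have [N hN] := hU _ hx.
have [C hC] : exists C : nat, forall i j, (- (C%:Z)%:E <= v (T i j))%E.
  have h i j : exists c : nat, (- (c%:Z)%:E <= v (T i j))%E.
    have [->|T0] := eqVneq (T i j) 0; first by exists 0%N; rewrite (valuation0 hv) leey.
    have [a0 ->] := val_fin hv T0; exists `|a0|%N; rewrite -EFinN lee_fin; lia.
  pose c i j := projT1 (cid (h i j)).
  have hc i j : (- ((c i j)%:Z)%:E <= v (T i j))%E by rewrite /c; case: cid.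
  exists (\max_i \max_j c i j) => i j; apply: le_trans (hc i j).
  rewrite -!EFinN lee_fin lerN2 lez_nat.
  exact: leq_trans (leq_bigmax j) (leq_bigmax (F := fun i => \max_j c i j)%N i).
exists (N + C%:Z) => y hy; apply: hN => j.
have -> : (y *m T + a) 0 j - (x *m T + a) 0 j = \sum_k (y 0 k - x 0 k) * T k j.
  rewrite !mxE opprD addrACA subrr addr0 -sumrB.
  by apply: eq_bigr => k _; rewrite mulrBl.
elim/big_ind: _ => [|u w hu hw|k _].
- by rewrite (valuation0 hv) leey.
- exact: (val_ge_add hv).
- rewrite (nvM hv); apply: le_trans (leeD (hy k) (hC k j)).
  by rewrite -EFinN -EFinD lee_fin; lia.
Qed.

Variable R : realType.
Implicit Types mu : {measure set (borel_affine v n) -> \bar R}.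

(** Haar measure without its normalization, because the rescaled measures have a smaller mass on the
    integral points. *)
Definition tinv mu := forall (a : X) (A : set (borel_affine v n)),
  measurable A -> mu [set (a + x : X) | x in A] = mu A.

Lemma translate_measurable (a : X) (A : set (borel_affine v n)) :
  measurable A -> measurable ([set (a + x : X) | x in A] : set (borel_affine v n)).
Proof.
move=> mA; have := linear_measurable 1%:M (- a) measurableT mA.
rewrite setTI; congr measurable; apply/seteqP; split => x /=.
  by rewrite mulmx1 => h; exists (x - a) => //; rewrite addrC subrK.
by move=> [y Ay <-]; rewrite mulmx1 addrAC subrr add0r.
Qed.

Lemma measure_fibers mu (G : finType) (A : set X) (phi : X -> G) :
  (forall z, measurable (A `&` [set x | phi x = z] : set (borel_affine v n))) ->
  mu A = (\sum_z mu (A `&` [set x | phi x = z]))%E.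
Proof.
move=> mA.
have H (s : seq G) : uniq s ->
   measurable (A `&` [set x | phi x \in s] : set (borel_affine v n)) /\
   mu (A `&` [set x | phi x \in s]) = (\sum_(z <- s) mu (A `&` [set x | phi x = z]))%E.
  elim: s => [_|z s IH /= /andP[zs us]].
    have -> : A `&` [set x | phi x \in [::]] = set0 by apply/seteqP; split => // x [].
    by rewrite big_nil measure0; split => //; exact: measurable0.
  have [m1 m2] := IH us.
  have -> : A `&` [set x | phi x \in z :: s] =
     (A `&` [set x | phi x = z]) `|` (A `&` [set x | phi x \in s]).
    rewrite -setIUr; congr (_ `&` _); apply/seteqP; split => x /=.
      by rewrite in_cons => /orP[/eqP|]; [left|right].
    by rewrite in_cons => -[->|->]; rewrite ?eqxx ?orbT.
  split; first exact: measurableU.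
  rewrite big_cons -m2 measureU //; apply/seteqP; split => // x /= [[_ Ez] [_ h]].
  by rewrite -Ez h in zs.
have [_ <-] := H _ (index_enum_uniq G); congr (mu _); apply/seteqP; split => [x Ax|x []//].
by split => //=; exact: mem_index_enum.
Qed.

(* Translation invariance makes all the fibres of [phi] equally large. *)
Lemma uniform_fiber mu (G : finZmodType) (A : set X) (phi : X -> G) (h : G -> X) (a : R) :
  tinv mu ->
  (forall z, measurable (A `&` [set x | phi x = z] : set (borel_affine v n))) ->
  (forall x s, A x -> A (x + h s) /\ phi (x + h s) = phi x + s) ->
  mu A = a%:E -> forall z, mu (A `&` [set x | phi x = z]) = (a / #|G|%:R)%:E.
Proof.
move=> tmu mA hh muA.
(* Translation by [h (z' - z)] carries the fibre over z into the fibre over z'; by symmetry all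
   fibres have equal measure. *)
have le z z' : (mu (A `&` [set x | phi x = z]) <= mu (A `&` [set x | phi x = z']))%E.
  rewrite -(tmu (h (z' - z)) _ (mA z)); apply: le_measure; rewrite ?inE //.
    exact: translate_measurable.
  move=> _ [x [Ax /= Ez] <-]; have [h1 h2] := hh _ (z' - z) Ax.
  by rewrite addrC; split => //=; rewrite h2 Ez addrC subrK.
move=> z; have := measure_fibers mu mA; rewrite muA.
rewrite (eq_bigr (fun=> mu (A `&` [set x | phi x = z]))); last first.
  by move=> z' _; apply/eqP; rewrite eq_le !le.
(* The common value has to be finite: an infinite one would make the measure of A infinite. *)
have: (0 <= mu (A `&` [set x | phi x = z]))%E by exact: measure_ge0.
have q0 : (0 < #|G|)%N by apply/card_gt0P; exists 0.
case: (mu _) => [b b0| |//] /=.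
  rewrite sumEFin sumr_const => -[->]; congr _%:E.
  by rewrite -[b *+ _]mulr_natr mulfK // pnatr_eq0 -lt0n.
move=> _; rewrite (bigD1 z) //= addye //.
by apply/eqP => /esum_eqNyP [? [_ _ []]].
Qed.

Lemma measure_diff_fin mu (A B : set X) (a b : R) :
  measurable (A : set (borel_affine v n)) -> measurable (B : set (borel_affine v n)) ->
  B `<=` A -> mu A = a%:E -> mu B = b%:E -> mu (A `\` B) = (a - b)%:E.
Proof.
move=> mA mB BA Ea Eb; have E : A `&` B = B by rewrite setIC; exact: setIidl.
rewrite measureD //; last by rewrite [X in (X < _)%E]Ea ltry.
by rewrite E [X in (X - _)%E]Ea [X in (_ - X)%E]Eb.
Qed.

Section Pushforward.
Variables (mu : {measure set (borel_affine v n) -> \bar R}) (T T' : 'M[K]_n).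
Hypothesis tmu : tinv mu.
Hypothesis TT' : T *m T' = 1%:M.

(** Pushforward along x |-> x T'. A translation by a downstairs is induced by the translation by a T
    upstairs, so invariance is inherited. *)
Lemma pushforward_linear : exists2 nu : {measure set (borel_affine v n) -> \bar R},
  tinv nu & forall A, nu A = mu [set x : X | A (x *m T')].
Proof.
pose f : borel_affine v n -> borel_affine v n := fun x => (x : X) *m T' + 0.
have mf : measurable_fun setT f by exact: linear_measurable.
have E A : pushforward mu f A = mu [set x : X | A (x *m T')].
  by rewrite /pushforward; congr (mu _); apply/seteqP; split => x; rewrite /f /= addr0.
exists (measure_function_pushforward__canonical__measure_function_Measure mu mf) => //.
move=> a A mA; rewrite [LHS]E [RHS]E -[RHS](tmu (a *m T)).
  congr (mu _); apply/seteqP; split => x /=.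
    move=> [y Ay Ey]; exists (x - a *m T); last by rewrite addrC subrK.
    by rewrite mulmxBl -mulmxA TT' mulmx1 -Ey addrAC subrr add0r.
  move=> [y Ay <-]; exists (y *m T') => //.
  by rewrite mulmxDl -mulmxA TT' mulmx1.
rewrite -[X in measurable X](setTI _).
have -> : [set x : X | A (x *m T')] = f @^-1` A.
  by apply/seteqP; split => x; rewrite /f /= addr0.
exact: mf.
Qed.

End Pushforward.

End LocallyConstant.

(** * Volumes of level sets *)

Definition dquad (K : fieldType) n (alpha beta : 'I_n -> K) (gamma : K) (y : 'rV[K]_n) : K :=
  \sum_i (alpha i * y 0 i ^+ 2 + beta i * y 0 i) + gamma.

Section Volumes.
Variables (K : fieldType) (v : K -> \bar int).
Hypothesis hv : normalized_valuation v.
Variable pi : K.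
Hypothesis hpi : v pi = 1%:E.
Variables (F : finFieldType) (red : K -> F).
Hypothesis hred : residue_map v red.
Variable n : nat.
Local Notation X := 'rV[K]_n.
Local Notation intset := (@intset K v n).
Local Notation locset := (@locset K v n).
Local Notation vcong := (@vcong K v n).
Variables (R : realType) (mu : {measure set (borel_affine v n) -> \bar R}).
Hypothesis tmu : tinv mu.
Local Notation q := (#|F|%:R : R).

Lemma qR_neq0 : q != 0. Proof. exact: card_neq0. Qed.

(** * Level sets of a function that is 1-Lipschitz on the integral points *)

Section Levels.
Variable g : X -> K.
Hypothesis hlip : forall k x y, intset x -> vcong k x y -> vdvd v k (g y - g x).

Lemma locset_ge k : locset k (intset `&` [set x | vdvd v k (g x)]).
Proof.
move=> x y h [ix hx]; split; first exact: (locset_int hv (vcongW (leq0n _) h) ix).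
by rewrite /= -(subrK (g x) (g y)) (vdvdD hv) // hlip.
Qed.

Lemma locset_ltn k : locset k (intset `&` [set x | ~~ vdvd v k (g x)]).
Proof.
move=> x y h [ix hx].
have iy : intset y by exact: (locset_int hv (vcongW (leq0n _) h) ix).
split => //=; apply: contra hx => hy; have [] // := @locset_ge k y x.
exact: vcong_sym.
Qed.

(** The exact valuation k is only visible modulo pi^(k+1), whence the shift in the level. *)
Lemma locset_val k : locset k.+1 (intset `&` [set x | v (g x) = (k%:Z)%:E]).
Proof.
have -> : intset `&` [set x | v (g x) = (k%:Z)%:E] =
  (intset `&` [set x | vdvd v k (g x)]) `&` (intset `&` [set x | ~~ vdvd v k.+1 (g x)]).
  apply/seteqP; split => x /=.
    by move=> [ix /val_eq_nat/andP[? ?]].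
  by move=> [[ix h1] [_ h2]]; split => //; apply/val_eq_nat; rewrite h1.
apply: locsetI; last exact: locset_ltn.
exact: locsetW (leqnSn k) (@locset_ge k).
Qed.

Section Descent.
Variables (A : set X) (k0 : nat) (i : 'I_n) (delta : F) (a : R).
Hypothesis A_int : A `<=` intset.
Hypothesis A_loc : locset k0 A.
Hypothesis A_ge : forall x, A x -> vdvd v k0 (g x).
Hypothesis delta0 : delta != 0.
Hypothesis A_dir : forall k x s, (k0 <= k)%N -> A x -> vdvd v 0 s ->
  exists2 d, vdvd v 0 d /\ red d = delta &
    g (x + (pi ^+ k * s) *: delta_mx 0 i) - g x = pi ^+ k * (s * d).
Hypothesis muA : mu A = a%:E.

Let level k := A `&` [set x | vdvd v k (g x)].

Lemma locset_level k : (k0 <= k)%N -> locset k (level k).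
Proof.
move=> hk; have -> : level k = A `&` (intset `&` [set x | vdvd v k (g x)]).
  by apply/seteqP; split => x /= => [[Ax h]|[Ax []]//]; do 2?split => //; exact: A_int.
by apply: locsetI; [exact: locsetW A_loc | exact: locset_ge].
Qed.

Lemma vcong_dir k s x : vdvd v 0 s -> vcong k x (x + (pi ^+ k * s) *: delta_mx 0 i).
Proof.
move=> hs j; rewrite !mxE addrAC subrr add0r.
by rewrite !(vdvdMl hv) ?(vdvd_nat hv) ?(vdvd_piX hv hpi).
Qed.

(** On the level k, [phi] is the digit of g at pi^k; it is equidistributed by [uniform_fiber], and
    its fibre over 0 is the next level. *)
Lemma measure_level m : mu (level (k0 + m)) = (a / q ^+ m)%:E.
Proof.
elim: m => [|m IH].
  rewrite addn0 expr0 divr1 -muA; congr (mu _); apply/seteqP; split => x; first by case.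
  by move=> Ax; split => //; exact: A_ge.
set k := (k0 + m)%N in IH *; have hk : (k0 <= k)%N by rewrite leq_addr.
pose phi x := red (g x / pi ^+ k).
(* Dividing by the directional derivative [delta] makes the digit move by exactly s. *)
pose h s := (pi ^+ k * lift_res hred (s / delta)) *: (delta_mx 0 i : X).
have phi0 x : level k x -> (phi x = 0) <-> vdvd v k.+1 (g x).
  move=> [_ hx]; rewrite -addn1 (vdvd_piV hv hpi) -(red_eq0 hred).
    by split => /eqP.
  by rewrite -(vdvd_piV hv hpi) addn0.
have dphi x y : level k x -> vcong k.+1 x y -> phi x = phi y.
  move=> [Ax hx] hxy; have hd := hlip (A_int Ax) hxy; rewrite /phi.
  have -> : g y / pi ^+ k = g x / pi ^+ k + (g y - g x) / pi ^+ k by ring.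
  have i1 : vdvd v 0 (g x / pi ^+ k) by rewrite -(vdvd_piV hv hpi) addn0.
  have i2 : vdvd v 1 ((g y - g x) / pi ^+ k) by rewrite -(vdvd_piV hv hpi) addn1.
  have i3 := vdvdW (leq0n _) i2.
  by move: i2; rewrite (redD' hred) // -(red_eq0 hred) // => /eqP ->; rewrite addr0.
have mfib z : measurable (level k `&` [set x | phi x = z] : set (borel_affine v n)).
  apply: (@locset_measurable _ _ _ k.+1) => x y hxy [hx /= <-].
  split; first exact: (locset_level hk (vcongW (leqnSn k) hxy) hx).
  by rewrite /= (dphi x y).
have := @uniform_fiber _ _ hv _ _ mu _ (level k) phi h _ tmu mfib _ IH 0.
rewrite exprSr invfM mulrA => <-; last first.
  move=> x s lx; have hs := lift_res_int hred (s / delta).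
  split; first exact: (locset_level hk (vcong_dir k _ hs) lx).
  have [d [id rd] Ed] := A_dir hk lx.1 hs; rewrite /phi /h.
  rewrite -(subrK (g x) (g _)) Ed mulrDl addrC.
  rewrite [pi ^+ k * _]mulrC mulfK ?(piX_neq0 hv hpi) // (redD' hred); last first.
  - exact: (vdvdMl hv).
  - by have [_ /=] := lx; rewrite -[k in vdvd v k _]addn0 (vdvd_piV hv hpi).
  by rewrite [red (lift_res _ _ * d)](redM' hred) // rd (lift_resK hred) divfK.
congr (mu _); apply/seteqP; split => x.
  move=> [Ax hx]; have lx : level k x by split => //; apply: vdvdW hx; rewrite addnS.
  by split => //; apply/(phi0 x lx); rewrite -addnS.
by move=> [lx /(phi0 x lx) hx]; split; [exact: lx.1 | rewrite /= addnS].
Qed.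

Lemma measure_val m :
  mu (A `&` [set x | v (g x) = (Posz (k0 + m))%:E]) = (a * (1 - q^-1) / q ^+ m)%:E.
Proof.
have q0 := qR_neq0.
have -> : a * (1 - q^-1) / q ^+ m = a / q ^+ m - a / q ^+ m.+1.
  by rewrite exprS; field; rewrite expf_neq0.
rewrite -(@measure_diff_fin _ _ _ _ mu (level (k0 + m)) (level (k0 + m.+1))).
- congr (mu _); apply/seteqP; split => x /=.
    by move=> [Ax /val_eq_nat/andP[h1 h2]]; split => // -[_]; rewrite addnS; apply/negP.
  move=> [[Ax h1] h2]; split => //; apply/val_eq_nat; rewrite [vdvd _ _ _]h1 /=.
  by apply/negP => h3; apply: h2; split => //; rewrite addnS.
- by apply: (@locset_measurable _ _ _ (k0 + m)); apply: locset_level; rewrite leq_addr.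
- by apply: (@locset_measurable _ _ _ (k0 + m.+1)); apply: locset_level; rewrite leq_addr.
- by move=> x [Ax h]; split => //; apply: vdvdW h; rewrite addnS.
- exact: measure_level.
- exact: measure_level.
Qed.

End Descent.
End Levels.

Variable V : R.
Hypothesis muV : mu intset = V%:E.

Definition redv (x : X) : 'rV[F]_n := \row_i red (x 0 i).

Lemma locset_redv z : locset 1 (intset `&` [set x | redv x = z]).
Proof.
move=> x y h [ix <-]; have iy : intset y := locset_int hv (vcongW (leq0n _) h) ix.
split => //; apply/rowP => j; rewrite !mxE; apply/eqP.
by rewrite (red_eq hv hred) //; [exact: iy | exact: ix].
Qed.

(** The q^n residue classes are translates of one another by lifts of residue vectors. *)
Lemma measure_redv z : mu (intset `&` [set x | redv x = z]) = (V / q ^+ n)%:E.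
Proof.
pose h (s : 'rV[F]_n) : X := \row_i lift_res hred (s 0 i).
have := @uniform_fiber _ _ hv _ _ mu _ intset redv h V tmu _ _ muV z.
rewrite card_mx mul1n natrX; apply=> [z'|x s ix].
  by apply: (@locset_measurable _ _ _ 1); exact: locset_redv.
have il j : vdvd v 0 (lift_res hred (s 0 j)) by exact: lift_res_int.
split.
  by move=> j; rewrite !mxE; apply: (vdvdD hv) => //; exact: ix.
by apply/rowP => j; rewrite !mxE (redD' hred) ?lift_resK //; exact: ix.
Qed.

Variables (alpha beta : 'I_n -> K) (gamma : K).
Hypothesis ialpha : forall i, vdvd v 0 (alpha i).
Hypothesis ibeta : forall i, vdvd v 0 (beta i).
Hypothesis igamma : vdvd v 0 gamma.
Local Notation g := (dquad alpha beta gamma).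

Lemma dquad_int x : intset x -> vdvd v 0 (g x).
Proof.
move=> ix; rewrite (vdvdD hv) //; apply: (vdvd_sum hv) => i _.
by rewrite (vdvdD hv) // (vdvdMl hv) ?(vdvdX hv) //; exact: ix.
Qed.

Lemma dquad_lip k x y : intset x -> vcong k x y -> vdvd v k (g y - g x).
Proof.
move=> ix h; have iy : intset y := locset_int hv (vcongW (leq0n _) h) ix.
rewrite /dquad opprD addrACA subrr addr0 -sumrB; apply: (vdvd_sum hv) => i _.
have -> : alpha i * y 0 i ^+ 2 + beta i * y 0 i - (alpha i * x 0 i ^+ 2 + beta i * x 0 i) =
   (y 0 i - x 0 i) * (alpha i * (y 0 i + x 0 i) + beta i) by ring.
have hx : vdvd v 0 (x 0 i) by exact: ix.
have hy : vdvd v 0 (y 0 i) by exact: iy.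
by apply: (vdvdMl hv) => //; rewrite (vdvdD hv) // (vdvdMl hv) // (vdvdD hv).
Qed.

Lemma dquad_dir x s i :
  g (x + s *: delta_mx 0 i) - g x = s * (alpha i * (2%:R * x 0 i + s) + beta i).
Proof.
rewrite /dquad opprD addrACA subrr addr0 -sumrB (bigD1 i) //= big1 => [|j ji].
  by rewrite !mxE !eqxx /= mulr1n; ring.
by rewrite !mxE (negPf ji) andbF mulr0n mulr0 addr0 subrr.
Qed.

(** In the direction i the function is affine with unit slope, so all integral points are smooth and
    the descent starts at level 0. *)
Lemma measure_linear i m : alpha i = 0 -> v (beta i) = 0%:E ->
  mu (intset `&` [set x | v (g x) = (m%:Z)%:E]) = (V * (1 - q^-1) / q ^+ m)%:E.
Proof.
move=> a0 ub; apply: (@measure_val _ dquad_lip intset 0 i (red (beta i)) V) => //.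
- exact: locset_int.
- by move=> x; exact: dquad_int.
- by apply/(red_neq0 hred).
- move=> k x s _ ix hs; exists (beta i) => //.
  by rewrite dquad_dir a0 mul0r add0r mulrA.
Qed.

Hypothesis pbeta : forall i, vdvd v 1 (beta i).
Hypothesis h2 : v 2%:R = 0%:E.
Local Notation ralpha := (fun i => red (alpha i)).

(** The singular residues: as the [beta i] reduce to 0 and 2 is invertible, these are the points
    where the gradient of [qbar] vanishes. *)
Definition nullv (z : 'rV[F]_n) := [forall i, (ralpha i != 0) ==> (z 0 i == 0)].
Definition qbar (z : 'rV[F]_n) := \sum_i red (alpha i) * z 0 i ^+ 2 + red gamma.

Lemma red_dquad x : intset x -> red (g x) = qbar (redv x).
Proof.
move=> ix; have ix' i : vdvd v 0 (x 0 i) by exact: ix.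
have ib i : vdvd v 1 (beta i * x 0 i) by apply: (vdvdMl hv).
rewrite /dquad (redD' hred) //; last first.
  apply: (vdvd_sum hv) => i _.
  by rewrite (vdvdD hv) // (vdvdMl hv) // (vdvdX hv).
rewrite (red_sum hv hred); last first.
  by move=> i _; rewrite (vdvdD hv) // (vdvdMl hv) // (vdvdX hv).
congr (_ + _); apply: eq_bigr => i _; rewrite mxE.
rewrite (redD' hred) ?(vdvdMl hv) ?(vdvdX hv) //.
rewrite (redM' hred) ?(redX hv hred) ?(vdvdX hv) //.
by have := ib i; rewrite -(red_eq0 hred) ?(vdvdMl hv) // => /eqP ->; rewrite addr0.
Qed.

Lemma red2 : red 2%:R = 2%:R.
Proof. by rewrite -natr1 (redD' hred) ?(vdvd1 hv) // (red1 hred). Qed.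

Lemma red2_neq0 : 2%:R != 0 :> F.
Proof. by rewrite -red2; apply/(red_neq0 hred) => //; exact: vdvd_nat. Qed.

(** The share of the residue class z, restricted to smooth points, on which g has valuation k. *)
Definition vol_coef (z : 'rV[F]_n) (k : nat) : R :=
  if nullv z then 0 else
  if k is m.+1 then (qbar z == 0)%:R * ((1 - q^-1) / q ^+ m) else (qbar z != 0)%:R.

Definition smooth : set X := intset `&` [set x | ~~ nullv (redv x)].

Lemma locset_smooth : locset 1 smooth.
Proof.
move=> x y h [ix hx]; have [] // := @locset_redv (redv x) x y h.
by move=> iy /= E; split => //=; rewrite E.
Qed.

(** If [qbar z] is nonzero, g is a unit on the whole class. Otherwise some active coordinate of z is
    nonzero, and the descent starts at level 1 with derivative 2 alpha_i z_i. *)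
Lemma measure_smooth_class z k :
  mu ((smooth `&` [set x | v (g x) = (k%:Z)%:E]) `&` [set x | redv x = z])
  = (V / q ^+ n * vol_coef z k)%:E.
Proof.
have E0 (S : set X) : S `<=` set0 -> mu S = (V / q ^+ n * 0)%:E.
  by move=> h; rewrite mulr0 (_ : S = set0) ?measure0 //; apply/seteqP; split.
rewrite /vol_coef; case: (boolP (nullv z)) => hz.
  by apply: E0 => x [[[_ /= h] _] /= Ez]; rewrite Ez hz in h.
have [i hi zi0] : exists2 i, red (alpha i) != 0 & z 0 i != 0.
  move: hz; rewrite negb_forall => /existsP -[j]; rewrite negb_imply => /andP[h1 h3].
  by exists j.
set C := intset `&` [set x | redv x = z].
have EC : (smooth `&` [set x | v (g x) = (k%:Z)%:E]) `&` [set x | redv x = z]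
    = C `&` [set x | v (g x) = (k%:Z)%:E].
  apply/seteqP; split => x /=; first by move=> [[[? _] ?] ?].
  by move=> [[ix Ez] hx]; split => //; split => //; split => //=; rewrite Ez.
have gC x : C x -> (red (g x) == 0) = (qbar z == 0).
  by move=> [ix Ez]; rewrite red_dquad // Ez.
rewrite EC; case: (eqVneq (qbar z) 0) => hq.
  have A_ge x : C x -> vdvd v 1 (g x).
    by move=> hx; rewrite -(red_eq0 hred) ?gC ?hq //; apply: dquad_int; case: hx.
  case: k {EC} => [|m].
    by apply: E0 => x [Cx /= /val_eq_nat/andP[_]]; rewrite A_ge.
  rewrite mul1r mulrA.
  apply: (@measure_val _ dquad_lip C 1 i (2%:R * red (alpha i) * z 0 i) (V / q ^+ n)) => //.
  - by move=> x [].
  - exact: locset_redv.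
  - by rewrite !mulf_neq0 // red2_neq0.
  (* The difference quotient contains the quadratic term pi^k s; it drops out of the reduction
     because k >= 1. *)
  - move=> k x s hk [ix Ez] hs; exists (alpha i * (2%:R * x 0 i + pi ^+ k * s) + beta i); last first.
      by rewrite dquad_dir mulrA.
    have ixi : vdvd v 0 (x 0 i) by exact: ix.
    have i2 : vdvd v 0 (2%:R * x 0 i) by rewrite (vdvdMl hv) // (vdvd_nat hv).
    have p1 : vdvd v 1 (pi ^+ k * s).
      by apply: (vdvdMl hv) => //; apply: vdvdW hk _; exact: vdvd_piX.
    have p0 := vdvdW (leq0n _) p1.
    split; first by rewrite (vdvdD hv) // (vdvdMl hv) // (vdvdD hv).
    have rb : red (beta i) = 0 by apply/eqP; rewrite (red_eq0 hred).
    have rp : red (pi ^+ k * s) = 0 by apply/eqP; rewrite (red_eq0 hred).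
    rewrite (redD' hred) ?(vdvdMl hv) ?(vdvdD hv) // rb addr0.
    rewrite (redM' hred) ?(vdvdD hv) // (redD' hred) // rp addr0.
    rewrite (redM' hred) ?(vdvd_nat hv) // -Ez mxE.
    by rewrite red2 mulrA [red _ * _]mulrC.
  - exact: measure_redv.
have ug x : C x -> v (g x) = 0%:E.
  move=> hx; apply/(red_neq0 hred); first by apply: dquad_int; case: hx.
  by rewrite gC.
case: k {EC} => [|m].
  rewrite mulr1 -(measure_redv z); congr (mu _); apply/seteqP; split => x; first by case.
  by move=> hx; split => //=; exact: ug.
by rewrite mul0r; apply: E0 => x [Cx /=]; rewrite ug.
Qed.

Lemma measure_smooth k : mu (smooth `&` [set x | v (g x) = (k%:Z)%:E])
  = (V * ((\sum_z vol_coef z k) / q ^+ n))%:E.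
Proof.
rewrite (@measure_fibers _ _ _ _ mu _ _ redv).
  under eq_bigr do rewrite measure_smooth_class.
  by rewrite sumEFin -mulr_sumr; congr _%:E; ring.
move=> z; have -> : (smooth `&` [set x | v (g x) = (k%:Z)%:E]) `&` [set x | redv x = z]
   = smooth `&` (intset `&` [set x | v (g x) = (k%:Z)%:E]) `&` (intset `&` [set x | redv x = z]).
  apply/seteqP; split => x /=; first by move=> [[[? ?] ?] ?].
  by move=> [[[? ?] [? ?]] [? ?]].
apply: (@locset_measurable _ _ _ k.+1); apply: locsetI; [apply: locsetI|].
- exact: locsetW locset_smooth.
- exact: locset_val dquad_lip k.
- exact: locsetW (@locset_redv z).
Qed.

Definition active_rank := diag_rank ralpha.

Lemma measure_null : mu (intset `&` [set x | nullv (redv x)]) = (V / q ^+ active_rank)%:E.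
Proof.
rewrite (@measure_fibers _ _ _ _ mu _ _ redv).
  rewrite (eq_bigr (fun z => (V / q ^+ n * (nullv z)%:R)%:E)); last first.
    move=> z _; case: (boolP (nullv z)) => hz.
      rewrite mulr1 -(measure_redv z); congr (mu _); apply/seteqP; split => x /=.
        by move=> [[? _] ?].
      by move=> [? Ez]; rewrite Ez.
    rewrite mulr0 (_ : _ `&` _ = set0) ?measure0 //; apply/seteqP; split => // x [] /=.
    by move=> [_ h] Ez; rewrite Ez (negPf hz) in h.
  rewrite sumEFin -mulr_sumr -null_density; congr _%:E; rewrite /nullv; ring.
move=> z; have -> : (intset `&` [set x | nullv (redv x)]) `&` [set x | redv x = z]
   = if nullv z then intset `&` [set x | redv x = z] else set0.
  apply/seteqP; split => x; case: ifP => hz //=.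
  - by move=> [[? _] ?].
  - by move=> [[_ h] Ez]; rewrite Ez hz in h.
  - by move=> [? Ez]; rewrite Ez.
case: ifP => _; last exact: measurable0.
by apply: (@locset_measurable _ _ _ 1); exact: locset_redv.
Qed.

(** The density of all zeros of [qbar], less that of the singular ones. On singular residues [qbar]
    equals [red gamma], so they are zeros exactly when that is 0. *)
Definition zero_density : R :=
  quad_density_formula R active_rank (diag_disc ralpha) (- red gamma)
  - (red gamma == 0)%:R / q ^+ active_rank.

Definition smooth_density (k : nat) : R :=
  if k is m.+1 then zero_density * ((1 - q^-1) / q ^+ m)
  else 1 - (q ^+ active_rank)^-1 - zero_density.

Lemma zero_densityE :
  zero_density = (\sum_(z : 'rV[F]_n) (~~ nullv z && (qbar z == 0))%:R) / q ^+ n.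
Proof.
rewrite /zero_density -(quad_densityE red2_neq0) /quad_density /active_rank -null_density.
rewrite mulrA -mulrBl; congr (_ / _); rewrite mulr_sumr -sumrB; apply: eq_bigr => z _.
rewrite -/(nullv z) /qbar addr_eq0; case: (boolP (nullv z)) => hz; last by rewrite mulr0 subr0.
rewrite big1 ?[0 == _]eq_sym ?oppr_eq0 ?mulr1 ?subrr // => i _.
move/forallP: hz => /(_ i); have [->|_ /= /eqP ->] := eqVneq (red (alpha i)) 0.
  by rewrite mul0r.
by rewrite expr0n mulr0.
Qed.

Lemma measure_smoothE k : mu (smooth `&` [set x | v (g x) = (k%:Z)%:E])
  = (V * smooth_density k)%:E.
Proof.
rewrite measure_smooth; congr (V * _)%:E; rewrite /smooth_density /vol_coef.
have q0 := qR_neq0; case: k => [|m].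
  have E1 : (\sum_(z : 'rV[F]_n) 1) / q ^+ n = 1 :> R.
    by rewrite sumr_const card_mx mul1n natrX divff // expf_neq0.
  rewrite -[X in _ = X - _ - _]E1 zero_densityE /active_rank -null_density.
  rewrite -!mulrBl -!sumrB; congr (_ / _).
  apply: eq_bigr => z _; rewrite -/(nullv z).
  by case: (nullv z); case: eqP => _ /=; rewrite ?subr0 ?subrr.
rewrite zero_densityE [RHS]mulrAC [in RHS]mulr_suml; congr (_ / _); apply: eq_bigr => z _.
by case: (nullv z) => /=; rewrite ?mul0r.
Qed.

End Volumes.

(** * Decomposition into shells *)

(* The exponent of pi in front of a square that starts with exponent e, after j
   rescaling steps. *)
Definition level_exp (e j : nat) : nat := if (j <= e)%N then (e - j)%N else odd (j - e).

(** A step divides the form by pi. An active square has x replaced by pi x beforehand, so its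
    exponent goes from 0 to 2 - 1; every other exponent drops by one. *)
Lemma level_expS e j :
  level_exp e j.+1 = if level_exp e j == 0%N then 1%N else (level_exp e j).-1.
Proof.
rewrite /level_exp; case: (leqP j e) => h; case: (ltnP j e) => h'; rewrite ?subn_eq0.
- rewrite ifN; lia.
- have -> : j = e by lia.
  by rewrite leqnn subSnn.
- lia.
- by rewrite subSn ?(ltnW h) //=; case: (odd _).
Qed.

Lemma level_exp_eq0 e j : (level_exp e j == 0%N) = (e <= j)%N && (e == j %[mod 2])%N.
Proof.
rewrite /level_exp !modn2; case: leqP => h.
  by case: (ltngtP j e) h => // h' _; [lia | rewrite h' subnn !eqxx].
by rewrite (ltnW h) /= oddB ?(ltnW h) //; case: (odd j); case: (odd e).
Qed.

Section Shells.
Variables (K : fieldType) (v : K -> \bar int).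
Hypothesis hv : normalized_valuation v.
Hypothesis h2 : v 2%:R = 0%:E.
Variable pi : K.
Hypothesis hpi : v pi = 1%:E.
Variables (F : finFieldType) (red : K -> F).
Hypothesis hred : residue_map v red.
Variable n : nat.
Local Notation X := 'rV[K]_n.
Local Notation intset := (@intset K v n).
Variables (R : realType).
Implicit Types mu nu : {measure set (borel_affine v n) -> \bar R}.
Local Notation q := (#|F|%:R : R).

Variables (e : 'I_n -> nat) (u b : 'I_n -> K) (c : K).
Hypothesis hu : forall i, u i = 0 \/ v (u i) = 0%:E.
Hypothesis hub : forall i, u i != 0 -> b i = 0.

Definition lvl_alpha j i := u i * pi ^+ level_exp (e i) j.
Definition lvl_beta j i := b i / pi ^+ j.
Definition lvl_gamma j := c / pi ^+ j.
Definition lvl_form j := dquad (lvl_alpha j) (lvl_beta j) (lvl_gamma j).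
Definition lvl_rank j := active_rank red (lvl_alpha j).
Definition lvl_vol j : R := \prod_(i < j) (q ^+ lvl_rank i)^-1.
Definition lvl_density j := smooth_density red R (lvl_alpha j) (lvl_gamma j).
Definition active j i := (u i != 0) && (level_exp (e i) j == 0%N).

Lemma int_u i : vdvd v 0 (u i).
Proof. by case: (hu i) => [->|/unit_vdvd//]; exact: vdvd0. Qed.

Lemma int_alpha j i : vdvd v 0 (lvl_alpha j i).
Proof. by rewrite (vdvdMl hv) ?int_u //; apply: (vdvdW (leq0n _)) (vdvd_piX hv hpi _). Qed.

Lemma red_alpha j i : (red (lvl_alpha j i) != 0) = active j i.
Proof.
rewrite (red_eq0 hred) ?int_alpha // /lvl_alpha /active.
case: (hu i) => [->|ui]; first by rewrite mul0r (vdvd0 hv) eqxx.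
rewrite (vdvd_unit hv) // (unit_neq0 hv ui) /=; case: (level_exp _ _) => [|k] /=.
  by apply/val_unitE; rewrite ?expr0 ?(valuation1 hv) // (vdvd1 hv).
by apply/negbTE; rewrite negbK; apply: (vdvdW _) (vdvd_piX hv hpi _).
Qed.

(** Divisibility of b by pi^(j+1) makes the linear part of [lvl_form j] vanish in the residue field,
    as the computation of the smooth part requires. *)
Lemma level_split j nu V : tinv nu -> nu intset = V%:E ->
  (forall i, vdvd v j.+1 (b i)) -> vdvd v j c -> forall m : nat,
  nu (intset `&` [set x | v (lvl_form j x) = (m%:Z)%:E]) =
    ((V * lvl_density j m)%:E +
     nu ((intset `&` [set x | v (lvl_form j x) = (m%:Z)%:E])
         `&` [set x | nullv red (lvl_alpha j) (redv red x)]))%E.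
Proof.
move=> tnu nuV hb hc m; have ia := int_alpha j.
have pb i : vdvd v 1 (lvl_beta j i) by rewrite /lvl_beta -(vdvd_piV hv hpi) addn1.
have ib i : vdvd v 0 (lvl_beta j i) by apply: vdvdW (pb i).
have ig : vdvd v 0 (lvl_gamma j) by rewrite /lvl_gamma -(vdvd_piV hv hpi) addn0.
have hlip := @dquad_lip _ _ hv _ _ _ (lvl_gamma j) ia ib.
pose N x := nullv red (lvl_alpha j) (redv red x).
rewrite (@measure_fibers _ _ _ _ nu _ _ N); last first.
  move=> z; apply: (@locset_measurable _ _ _ m.+1) => x y hxy [[ix /= hx] hz].
  have [iy /= hy] : (intset `&` [set x | v (lvl_form j x) = (m%:Z)%:E]) y.
    by apply: (locset_val hv hlip hxy); split.
  split => //=; rewrite -hz /N.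
  have hxy1 := vcongW (ltn0Sn m) hxy.
  by have [_ /= ->] := @locset_redv _ _ hv _ _ hred _ _ _ _ hxy1 (conj ix erefl).
rewrite big_bool addrC; congr (_ + _)%E.
rewrite /lvl_density -(measure_smoothE hv hpi hred tnu nuV ia ib ig pb h2 m).
congr (nu _); apply/seteqP; split => x /=.
  by move=> [[ix hx] /negP hN]; split => //; split => //=; apply/negP.
by move=> [[ix /= hN] hx]; do 2?split => //; apply/negbTE.
Qed.

(** Here c / pi^j is a unit, and on the singular points the form reduces to it. They all have
    valuation 0, and no further rescaling occurs. *)
Lemma last_level j nu V : tinv nu -> nu intset = V%:E ->
  (forall i, vdvd v j.+1 (b i)) -> v c = (j%:Z)%:E -> forall m : nat,
  nu (intset `&` [set x | v (lvl_form j x) = (m%:Z)%:E]) =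
    (V * lvl_density j m + (if m == 0%N then V / q ^+ lvl_rank j else 0))%:E.
Proof.
move=> tnu nuV hb vc m; have ia := int_alpha j.
have hc : vdvd v j c by rewrite /vdvd vc.
rewrite (level_split tnu nuV hb hc) EFinD; congr (_ + _)%E.
have pb i : vdvd v 1 (lvl_beta j i) by rewrite /lvl_beta -(vdvd_piV hv hpi) addn1.
have ib i : vdvd v 0 (lvl_beta j i) by apply: vdvdW (pb i).
have ig : vdvd v 0 (lvl_gamma j) by rewrite /lvl_gamma -(vdvd_piV hv hpi) addn0.
have ug : v (lvl_gamma j) = 0%:E.
  apply/(val_unitE ig); rewrite /lvl_gamma -(vdvd_piV hv hpi) addn1.
  by move/val_eq_nat: vc => /andP[].
have uN x : intset x -> nullv red (lvl_alpha j) (redv red x) -> v (lvl_form j x) = 0%:E.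
  move=> ix /forallP hN; apply/(red_neq0 hred); first exact: (dquad_int hv).
  rewrite (red_dquad hv hred) // /qbar big1 ?add0r; first exact/(red_neq0 hred).
  move=> i _; have := hN i; have [->|_ /= /eqP ->] := eqVneq (red (lvl_alpha j i)) 0.
    by rewrite mul0r.
  by rewrite expr0n mulr0.
case: m => [|m] /=.
  rewrite -(measure_null hv hred tnu nuV (lvl_alpha j)).
  congr (nu _); apply/seteqP; split => x /=; first by move=> [[ix hx] hN].
  by move=> [ix hN]; do 2?split => //; exact: uN.
rewrite (_ : _ `&` _ = set0) ?measure0 //; apply/seteqP; split => // x /= [[ix hx] hN].
by rewrite uN in hx.
Qed.

(** * One rescaling step *)

Section Step.
Variable j : nat.
Hypothesis hb : forall i, vdvd v j.+1 (b i).
Hypothesis hc : vdvd v j.+1 c.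

Let d i := if active j i then pi else 1.
Let T : 'M[K]_n := diag_mx (\row_i d i).
Let T' : 'M[K]_n := diag_mx (\row_i (d i)^-1).

Lemma d_neq0 i : d i != 0.
Proof. by rewrite /d; case: ifP => _; rewrite ?oner_neq0 ?(pi_neq0 hv hpi). Qed.

Lemma TT' : T *m T' = 1%:M.
Proof.
apply/matrixP => i k; rewrite mul_diag_mx !mxE; case: eqVneq => [->|]; rewrite ?mulr0 //.
by rewrite !mulr1n divff // d_neq0.
Qed.

Lemma mulT'E (x : X) i : (x *m T') 0 i = x 0 i / d i.
Proof. by rewrite mul_mx_diag !mxE. Qed.

(** Dividing the active coordinates by pi keeps a point integral exactly when it is a singular
    integral point. Hence the new measure of the integral points is the old measure of the singular
    ones. *)
Lemma int_mulT' (x : X) : intset (x *m T') <-> intset x /\ nullv red (lvl_alpha j) (redv red x).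
Proof.
split.
  move=> h; have h' i : vdvd v 0 (x 0 i / d i) by rewrite -mulT'E; exact: h.
  have E i : x 0 i = d i * (x 0 i / d i) by rewrite mulrC divfK // d_neq0.
  have id i : vdvd v 0 (d i).
    by rewrite /d; case: ifP => _; [apply: vdvdW (vdvd_piX hv hpi 1) | exact: vdvd1].
  have ix i : vdvd v 0 (x 0 i) by rewrite E (vdvdMl hv).
  split; first exact: ix.
  apply/forallP => i; rewrite red_alpha; apply/implyP => ai.
  rewrite mxE (red_eq0 hred) //; have := h' i; rewrite /d ai.
  by rewrite -[pi]expr1 -(vdvd_piV hv hpi).
move=> [ix /forallP h] i; rewrite -vdvd_int mulT'E /d; case: ifP => ai; last first.
  by rewrite divr1; exact: ix.
have := h i; rewrite red_alpha ai /= mxE (red_eq0 hred); last exact: ix.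
by rewrite -[pi]expr1 -(vdvd_piV hv hpi).
Qed.

(** The uniform division of the linear coefficients by pi is correct because, by [hub], a variable
    with a linear term has no square and is never rescaled. *)
Lemma lvl_formS (x : X) : lvl_form j x = pi ^+ 1 * lvl_form j.+1 (x *m T').
Proof.
have p0 := pi_neq0 hv hpi; have pj0 := piX_neq0 hv hpi j.
rewrite expr1 /lvl_form /dquad mulrDr mulr_sumr; congr (_ + _); last first.
  by rewrite /lvl_gamma exprS; field; rewrite p0 pj0.
apply: eq_bigr => i _; rewrite mulT'E /d /lvl_alpha /lvl_beta /active level_expS.
have [->|u0] /= := eqVneq (u i) 0.
  by rewrite !mul0r !add0r divr1 exprS; field; rewrite p0 pj0.
rewrite (hub u0) !mul0r !addr0; case: (level_exp _ _) => [|k] /=; first by field.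
by rewrite divr1 exprS; ring.
Qed.

Lemma int_formS (y : X) : intset y -> vdvd v 0 (lvl_form j.+1 y).
Proof.
move=> iy; apply: (dquad_int hv) => // [i|i|]; first exact: int_alpha.
- by rewrite /lvl_beta -(vdvd_piV hv hpi) addn0.
- by rewrite /lvl_gamma -(vdvd_piV hv hpi) addn0.
Qed.

Lemma shell_step nu V : tinv nu -> nu intset = V%:E ->
  exists nu', [/\ tinv nu', nu' intset = (V / q ^+ lvl_rank j)%:E &
    forall m, nu (intset `&` [set x | v (lvl_form j x) = (m%:Z)%:E]) =
      ((V * lvl_density j m)%:E + (if m is m'.+1 then
         nu' (intset `&` [set x | v (lvl_form j.+1 x) = (m'%:Z)%:E]) else 0))%E].
Proof.
move=> tnu nuV; have [nu' tnu' Enu'] := pushforward_linear hv tnu TT'.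
exists nu'; split => //.
  rewrite Enu' -(measure_null hv hred tnu nuV (lvl_alpha j)).
  by congr (nu _); apply/seteqP; split => x /int_mulT'.
move=> m; rewrite (level_split tnu nuV hb (vdvdW (leqnSn j) hc)); congr (_ + _)%E.
case: m => [|m].
  rewrite (_ : _ `&` _ = set0) ?measure0 //; apply/seteqP; split => // x.
  move=> [[ix /= hx] hN]; have /int_mulT' it : intset x /\ nullv red (lvl_alpha j) (redv red x) by [].
  move: hx; rewrite lvl_formS => /val_eq_nat/andP[_].
  by rewrite (vdvd_piM hv hpi 1 0) int_formS.
rewrite Enu'; congr (nu _); apply/seteqP; split => x /=.
  move=> [[ix hx] hN]; split; first exact/int_mulT'.
  by move: hx; rewrite lvl_formS; move/(val_eq_piM hv hpi 1 m).
move=> [/int_mulT' [ix hN] hx]; split => //; split => //.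
by rewrite lvl_formS; apply/(val_eq_piM hv hpi 1 m).
Qed.

End Step.

(** By shell i the form has been divided by pi^i, so that shell only meets valuations k >= i and
    enters with its density at k - i. The tests [i <= k] guard the truncated subtraction. *)
Lemma shell_decomposition mu j : tinv mu -> mu intset = 1%E ->
  (forall i, vdvd v j (b i)) -> vdvd v j c ->
  exists nu, [/\ tinv nu, nu intset = (lvl_vol j)%:E &
    forall k, mu (intset `&` [set x | v (lvl_form 0 x) = (k%:Z)%:E]) =
      ((\sum_(i < j) (if (i <= k)%N then lvl_vol i * lvl_density i (k - i) else 0))%:E
      + (if (j <= k)%N then
         nu (intset `&` [set x | v (lvl_form j x) = (Posz (k - j))%:E]) else 0))%E].
Proof.
move=> tmu mu1; elim: j => [|j IH] hb hc.
  exists mu; split => //; first by rewrite mu1 /lvl_vol big_ord0.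
  by move=> k; rewrite big_ord0 add0e subn0.
have [|| nu [tnu nuV Enu]] := IH; first by move=> i; apply: vdvdW (hb i).
  exact: vdvdW hc.
have [nu' [tnu' nuV' Enu']] := shell_step hb hc tnu nuV.
exists nu'; split => //; first by rewrite nuV' /lvl_vol big_ord_recr.
move=> k; rewrite Enu big_ord_recr /= EFinD -addeA; congr (_ + _)%E.
case: (ltngtP j k) => [jk|jk|<-]; last 2 first.
- by rewrite adde0.
- by rewrite subnn Enu'.
by rewrite Enu' -(subnSK jk).
Qed.

End Shells.

(** * Power series and limits in the complex numbers *)

Section ComplexLimits.
Variable R : realType.
Local Notation C := (R[i]).
Implicit Types (z t : C) (u : nat -> C).

(** The norm of R[i] takes values in R[i]; as a real number it is within reach of [lra], [nra] and
    real limits. *)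
Definition cmod z : R := complex.Re `|z|.

Lemma cmodE z : `|z| = (cmod z)%:C.
Proof. by rewrite /cmod RRe_real ?normr_real. Qed.
Lemma cmod_ge0 z : 0 <= cmod z.
Proof. by rewrite -ler0c -cmodE. Qed.
Lemma cmodM x y : cmod (x * y) = cmod x * cmod y.
Proof. by apply: complexI; rewrite -cmodE normrM !cmodE rmorphM. Qed.
Lemma cmodX x n : cmod (x ^+ n) = cmod x ^+ n.
Proof. by apply: complexI; rewrite -cmodE normrX cmodE rmorphXn. Qed.
Lemma cmodD x y : cmod (x + y) <= cmod x + cmod y.
Proof. by rewrite -lecR rmorphD /= -!cmodE ler_normD. Qed.
Lemma cmodR (x : R) : cmod x%:C = `|x|.
Proof. by rewrite /cmod normc_def /= expr0n addr0 sqrtr_sqr. Qed.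
Lemma cmodB x y : cmod (x - y) = cmod (y - x).
Proof. by apply: complexI; rewrite -!cmodE distrC. Qed.
Lemma cmod0 : cmod 0 = 0. Proof. by rewrite (cmodR 0) normr0. Qed.
Lemma cmod_sum (I : Type) (s : seq I) (P : pred I) (E : I -> C) :
  cmod (\sum_(i <- s | P i) E i) <= \sum_(i <- s | P i) cmod (E i).
Proof.
elim/big_rec2: _ => [|i x y _ h]; first by rewrite cmod0.
by apply: le_trans (cmodD _ _) _; rewrite lerD2l.
Qed.
Lemma cmodV x : cmod x^-1 = (cmod x)^-1.
Proof. by apply: complexI; rewrite -cmodE normfV cmodE fmorphV. Qed.
Lemma Re_le_cmod z : `|complex.Re z| <= cmod z.
Proof. by rewrite -lecR -cmodE normc_ge_Re. Qed.
Lemma Im_le_cmod z : `|complex.Im z| <= cmod z.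
Proof.
rewrite -(ler_pXn2r (isT : (0 < 2)%N)) ?nnegrE ?cmod_ge0 ?normr_ge0 //.
rewrite -lecR [X in _ <= X]rmorphXn /= -cmodE -add_Re2_Im2 lecR real_normK ?num_real //.
by rewrite lerDr sqr_ge0.
Qed.
Lemma cmod_lt1 t : `|t| < 1 -> cmod t < 1.
Proof. by rewrite cmodE -[1]/((1 : R)%:C) ltcR. Qed.

Definition Clim u l := forall eps : R, 0 < eps ->
  exists N, forall n, (N <= n)%N -> cmod (l - u n) < eps.

Lemma Clim_cvg u l : Clim u l -> (u : nat -> C^o) @ \oo --> (l : C^o).
Proof.
move=> h; apply/cvgrPdist_lt => eps eps0.
have Ee : (complex.Re eps)%:C = eps by rewrite RRe_real // gtr0_real.
have [|N hN] := h (complex.Re eps); first by rewrite -ltcR Ee.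
by exists N => // n /= /hN; rewrite -ltcR Ee -cmodE.
Qed.

Lemma Clim_real (P : C -> R) u l : (forall x y, P (x - y) = P x - P y) ->
  (forall x, `|P x| <= cmod x) -> Clim u l -> (fun n => P (u n)) @ \oo --> P l.
Proof.
move=> PB Ple h; apply/cvgrPdist_lt => eps /h [N hN].
by exists N => // n /= /hN; rewrite -PB; apply: le_lt_trans.
Qed.

Lemma Clim_ext u w l : u =1 w -> Clim u l -> Clim w l.
Proof. by move=> e h eps /h [N hN]; exists N => n /hN; rewrite e. Qed.
Lemma Clim_cst l : Clim (fun=> l) l.
Proof. by move=> eps e0; exists 0%N => n _; rewrite subrr cmod0. Qed.
Lemma ClimD u w l m : Clim u l -> Clim w m -> Clim (fun n => u n + w n) (l + m).
Proof.
move=> hu hw eps e0; have e2 : 0 < eps / 2 by lra.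
have [N1 h1] := hu _ e2; have [N2 h2] := hw _ e2.
exists (maxn N1 N2) => n; rewrite geq_max => /andP[/h1 a1 /h2 a2].
by rewrite opprD addrACA; apply: le_lt_trans (cmodD _ _) _; lra.
Qed.
Lemma ClimM c u l : Clim u l -> Clim (fun n => c * u n) (c * l).
Proof.
move=> hu eps e0; have c1 : 0 < cmod c + 1 by have := cmod_ge0 c; lra.
have [|N hN] := hu (eps / (cmod c + 1)); first by rewrite divr_gt0.
exists N => n /hN; rewrite -mulrBr cmodM ltr_pdivlMr // => h.
have := cmod_ge0 (l - u n); nra.
Qed.
Lemma Clim_sum (I : Type) (s : seq I) (w : I -> nat -> C) (l : I -> C) :
  (forall i, Clim (w i) (l i)) -> Clim (fun n => \sum_(i <- s) w i n) (\sum_(i <- s) l i).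
Proof.
move=> h; elim: s => [|i s IH].
  by apply: (Clim_ext _ (@Clim_cst _)) => n; rewrite !big_nil.
by rewrite big_cons; apply: Clim_ext (ClimD (h i) IH) => n; rewrite big_cons.
Qed.
Lemma Clim_shift j u l : Clim (fun n => u (j + n)%N) l -> Clim u l.
Proof.
move=> h eps /h [N hN]; exists (j + N)%N => n jn.
by rewrite -(subnKC (leq_trans (leq_addr N j) jn)) hN // leq_subRL ?(leq_trans _ jn) ?leq_addr.
Qed.

Lemma Clim_expr0 x : cmod x < 1 -> Clim (fun n => x ^+ n) 0.
Proof.
move=> x1 eps e0; have /cvgrPdist_lt : (fun n => cmod x ^+ n) @ \oo --> (0 : R).
  by apply: cvg_expr; rewrite ger0_norm ?cmod_ge0.
case/(_ _ e0) => N _ hN; exists N => n /hN /=.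
by rewrite (cmodB 0) subr0 cmodX sub0r normrN ger0_norm ?exprn_ge0 ?cmod_ge0.
Qed.

Lemma sub1_neq0 x : cmod x < 1 -> 1 - x != 0.
Proof.
move=> x1; rewrite subr_eq0; apply/eqP => e; move: x1; rewrite -e (cmodR 1).
by rewrite normr1 ltxx.
Qed.

Lemma geom_sum (x : C) n : x != 1 -> \sum_(0 <= k < n) x ^+ k = (1 - x ^+ n) / (1 - x).
Proof.
move=> x1; have h : 1 - x != 0 by rewrite subr_eq0 eq_sym.
apply: (mulIf h); rewrite divfK // big_mkord.
by apply: oppr_inj; rewrite opprB subrX1; ring.
Qed.

Lemma Clim_geom x : cmod x < 1 -> Clim (fun n => \sum_(0 <= k < n) x ^+ k) (1 - x)^-1.
Proof.
move=> x1; have h := sub1_neq0 x1.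
have := ClimD (Clim_cst (1 - x)^-1) (ClimM (- (1 - x)^-1) (Clim_expr0 x1)).
rewrite mulr0 addr0; apply: Clim_ext => n; rewrite geom_sum; first by ring.
by rewrite -subr_eq0 -oppr_eq0 opprB.
Qed.

Lemma cmod_div_nat (q : nat) t : (0 < q)%N -> cmod t < 1 -> cmod (t / q%:R) < 1.
Proof.
move=> q0 t1; rewrite cmodM cmodV -(rmorph_nat (real_complex R)) cmodR normr_nat.
by apply: le_lt_trans t1; rewrite ler_piMr ?cmod_ge0 // invf_le1 ?ltr0n // ler1n.
Qed.

Definition psum (a : nat -> R) t n := \sum_(0 <= k < n) (a k)%:C * t ^+ k.

Lemma psum_geom (q : nat) (s : nat -> R) A B t : (0 < q)%N -> cmod t < 1 -> s 0%N = A ->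
  (forall m, s m.+1 = B / q%:R ^+ m) ->
  Clim (psum s t) (A%:C + B%:C * t / (1 - t / q%:R)).
Proof.
move=> q0 t1 s0 sS; have tq := cmod_div_nat q0 t1.
apply: (@Clim_shift 1); have := ClimD (Clim_cst A%:C) (ClimM (B%:C * t) (Clim_geom tq)).
apply: Clim_ext => n; rewrite /psum big_nat_recl // s0 expr0 mulr1; congr (_ + _).
rewrite mulr_sumr; apply: eq_bigr => k _; rewrite sS exprMn exprVn exprS.
rewrite rmorphM /= fmorphV rmorphXn rmorph_nat; ring.
Qed.

Lemma psum_shift s t S j : Clim (psum s t) S ->
  Clim (psum (fun k => if (j <= k)%N then s (k - j)%N else 0) t) (t ^+ j * S).
Proof.
move=> h; apply: (@Clim_shift j); apply: Clim_ext (ClimM (t ^+ j) h) => n.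
rewrite /psum [RHS](@big_cat_nat _ _ _ j) ?leq_addr //= [X in X + _]big1_seq ?add0r; last first.
  by move=> k /=; rewrite mem_index_iota => kj; rewrite ifN ?mul0r //; lia.
rewrite -[j in \sum_(j <= _ < _) _]addn0 addnC -{2}[j]add0n big_addn addnK mulr_sumr.
apply: eq_bigr => k _; rewrite leq_addl addnK exprD; ring.
Qed.

Lemma psumD a a' t n : psum (fun k => a k + a' k) t n = psum a t n + psum a' t n.
Proof.
by rewrite /psum -big_split; apply: eq_bigr => k _; rewrite rmorphD /= mulrDl.
Qed.
Lemma psum_sum J (w : nat -> nat -> R) t n :
  psum (fun k => \sum_(i < J) w i k) t n = \sum_(i < J) psum (w i) t n.
Proof.
rewrite /psum exchange_big; apply: eq_bigr => k _.
by rewrite rmorph_sum /= mulr_suml.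
Qed.

(** Exchange of two limits: after J shells the remainder is at most |t|^J / (1 - |t|), uniformly in
    the truncation n. The partial sums of T need only approach Z along arbitrarily large J, which
    allows shells to be summed in pairs. *)
Lemma Clim_shells (vol : nat -> R) (sh : nat -> nat -> R) (T : nat -> C) (Z t : C) :
  cmod t < 1 ->
  (forall i, Clim (psum (sh i) t) (T i)) ->
  (forall J, exists rem : nat -> R, [/\ forall k, vol k = \sum_(i < J) sh i k + rem k,
     forall k, `|rem k| <= 1 & forall k, (k < J)%N -> rem k = 0]) ->
  (forall eps : R, 0 < eps -> forall J0, exists2 J, (J0 <= J)%N &
     cmod (Z - \sum_(i < J) T i) < eps) ->
  Clim (psum vol t) Z.
Proof.
move=> t1 hsh hrem hZ eps e0; have e3 : 0 < eps / 3 by lra.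
have t0 := cmod_ge0 t; have st : 0 < 1 - cmod t by lra.
have [|J0 hJ0] := Clim_expr0 t1 (_ : 0 < eps / 3 * (1 - cmod t)).
  exact: mulr_gt0.
have [J hJ ZJ] := hZ _ e3 J0; have [rem [Evol rem1 rem0]] := hrem J.
have [N hN] := Clim_sum (index_enum 'I_J) (fun i : 'I_J => hsh i) e3.
exists N => n Nn.
have -> : psum vol t n = \sum_(i < J) psum (sh i) t n + psum rem t n.
  rewrite -psum_sum -psumD; rewrite /psum; apply: eq_bigr => k _; by rewrite Evol.
have hr : cmod (psum rem t n) < eps / 3.
  apply: le_lt_trans (cmod_sum _ _ _) _.
  apply: (@le_lt_trans _ _ (cmod t ^+ J / (1 - cmod t))); last first.
    by rewrite ltr_pdivrMr // -cmodX -(subr0 (t ^+ J)) cmodB hJ0.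
  case: (leqP n J) => nJ.
    rewrite big1_seq; first by rewrite divr_ge0 ?exprn_ge0 // ltW.
    move=> k /=; rewrite mem_index_iota => kn; rewrite rem0 ?mul0r ?cmod0 //; lia.
  rewrite (@big_cat_nat _ _ _ J) ?(ltnW nJ) //= [X in X + _]big1_seq ?add0r; last first.
    by move=> k /=; rewrite mem_index_iota => kn; rewrite rem0 ?mul0r ?cmod0.
  apply: (@le_trans _ _ (\sum_(J <= k < n) cmod t ^+ k)).
    apply: ler_sum => k _; rewrite cmodM cmodR cmodX ler_piMl ?exprn_ge0 //.
  rewrite -{1}[J]add0n big_addn.
  have -> : \sum_(0 <= i < n - J) cmod t ^+ (i + J) =
            cmod t ^+ J * \sum_(0 <= i < n - J) cmod t ^+ i.
    by rewrite mulr_sumr; apply: eq_bigr => k _; rewrite addnC exprD.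
  apply: ler_wpM2l; first exact: exprn_ge0.
  rewrite -[X in _ <= X]mul1r ler_pdivlMr // big_mkord mulrC -opprB mulNr -subrX1 opprB.
  by rewrite gerBl exprn_ge0.
have h1 := hN n Nn.
have -> : Z - (\sum_(i < J) psum (sh i) t n + psum rem t n) =
  (Z - \sum_(i < J) T i) + ((\sum_(i < J) T i - \sum_(i < J) psum (sh i) t n)
     + (0 - psum rem t n)) by ring.
apply: le_lt_trans (cmodD _ _) _.
have := cmodD (\sum_(i < J) T i - \sum_(i < J) psum (sh i) t n) (0 - psum rem t n).
rewrite (cmodB 0) subr0; lra.
Qed.

Lemma Re_sub (x y : C) : complex.Re (x - y) = complex.Re x - complex.Re y.
Proof. by case: x y => [a b] [c d]. Qed.
Lemma Im_sub (x y : C) : complex.Im (x - y) = complex.Im x - complex.Im y.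
Proof. by case: x y => [a b] [c d]. Qed.

Lemma cpowM (a b : R) (s : C) : 0 < a -> 0 < b -> cpow (a * b) s = cpow a s * cpow b s.
Proof.
move=> a0 b0; rewrite /cpow !gt_eqF ?mulr_gt0 //.
rewrite lnM ?posrE // !mulrDr expRD cosD sinD; simpc; apply/eqP; rewrite eq_complex /=.
by apply/andP; split; apply/eqP; ring.
Qed.

Lemma cpowV (a : R) (s : C) : 0 < a -> cpow a^-1 s = cpow a (- s).
Proof.
move=> a0; rewrite /cpow !gt_eqF ?invr_gt0 // lnV ?posrE //.
by case: s => x y /=; rewrite !mulrN !mulNr.
Qed.

Lemma cpow1 (s : C) : cpow 1 s = 1.
Proof. by rewrite /cpow gt_eqF // ln1 !mulr0 expR0 cos0 sin0 mul1r. Qed.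

Lemma cpow_expV (a : R) (s : C) k : 0 < a -> cpow (a ^+ k)^-1 s = cpow a (- s) ^+ k.
Proof.
move=> a0; elim: k => [|k IH]; first by rewrite !expr0 invr1 cpow1.
by rewrite exprS invfM cpowM ?invr_gt0 ?exprn_gt0 // IH cpowV // exprS.
Qed.

Lemma cmod_cpow (a : R) (s : C) : 1 < a -> 0 < complex.Re s -> cmod (cpow a (- s)) < 1.
Proof.
move=> a1 s0; have a0 : 0 < a by lra.
rewrite /cpow gt_eqF // cmodM cmodR /cmod normc_def /= cos2Dsin2 sqrtr1 mulr1.
rewrite ger0_norm ?expR_ge0 // -expR0 ltr_expR.
case: s s0 => x y /= x0; have : 0 < ln a by rewrite ln_gt0.
nra.
Qed.

End ComplexLimits.

(** * Igusa integrals as power series *)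

Section DiscreteIntegral.
Variables (d : measure_display) (T : measurableType d) (R : realType).
Variables (mu : {measure set T -> \bar R}) (D : set T).
Hypothesis mD : measurable D.
Hypothesis mu1 : mu D = 1%E.

Lemma integrable_indic_in (A : set T) : measurable A ->
  mu.-integrable D (fun x => (\1_A x)%:E).
Proof.
move=> mA; apply/integrableP; split.
  by apply/measurable_EFinP; exact: measurable_indic.
under eq_integral => x _ do rewrite gee0_abs ?lee_fin //.
rewrite integral_indic //; apply: le_lt_trans (_ : (mu D < +oo)%E).
  by apply: le_measure; rewrite ?inE //; exact: measurableI.
by rewrite mu1 ltry.
Qed.

(** Dominated convergence for the partial sums, bounded by the constant 1 on a set of measure 1. The
    points outside every [A k] will be the zeros of f, where the convention 0 ^ s = 0 gives the
    value 0. *)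
Lemma Rintegral_discrete (A : nat -> set T) (phi : nat -> R) (h : T -> R) (l : R) :
  (forall k, measurable (A k)) -> (forall k, A k `<=` D) ->
  (forall j k x, A j x -> A k x -> j = k) ->
  (forall k, `|phi k| <= 1) ->
  (forall k x, A k x -> h x = phi k) ->
  (forall x, D x -> (forall k, ~ A k x) -> h x = 0) ->
  (fun n => \sum_(0 <= k < n) phi k * fine (mu (A k))) @ \oo --> l ->
  Rintegral mu D h = l.
Proof.
move=> mA AD disj phi1 hA h0 cl.
pose s n x := \sum_(0 <= k < n) phi k * \1_(A k) x : R.
have s_in n k x : A k x -> s n x = if (k < n)%N then phi k else 0.
  move=> Ax; rewrite /s; case: (ltnP k n) => kn.
    rewrite (bigD1_seq k) ?mem_index_iota ?iota_uniq //= big1 => [|j jk].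
      by rewrite indicE mem_set // mulr1 addr0.
    rewrite indicE memNset ?mulr0 // => Aj; move: jk.
    by rewrite (disj _ _ _ Aj Ax) eqxx.
  rewrite big1_seq // => j /=; rewrite mem_index_iota => jn.
  rewrite indicE memNset ?mulr0 // => Aj; have := disj _ _ _ Aj Ax; lia.
have s_out n x : (forall k, ~ A k x) -> s n x = 0.
  by move=> hx; rewrite /s big1 // => k _; rewrite indicE memNset ?mulr0.
have ms n : measurable_fun D (fun x => (s n x)%:E).
  apply/measurable_EFinP; apply: measurable_sum => k.
  by apply: measurable_funM => //; exact: measurable_indic.
have hcvg x : D x -> (fun n => (s n x)%:E) @ \oo --> (h x)%:E.
  move=> Dx; apply: cvg_EFin; first by near=> n.
  apply: cvg_near_cst; have [[k Ax]|hx] := pselect (exists k, A k x).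
    exists k.+1 => // n /= kn; by rewrite (s_in _ k) // kn (hA k).
  have hx' k : ~ A k x by move=> Ax; apply: hx; exists k.
  by exists 0%N => // n _ /=; rewrite s_out // h0.
have sle n x : D x -> (`|(s n x)%:E| <= 1)%E.
  move=> Dx; rewrite abse_EFin lee_fin; have [[k Ax]|hx] := pselect (exists k, A k x).
    by rewrite (s_in _ k) //; case: ifP => _ //; rewrite normr0.
  by rewrite s_out ?normr0 // => k Ax; apply: hx; exists k.
have i1 : mu.-integrable D (fun=> 1%E).
  apply: eq_integrable (integrable_indic_in measurableT) => // x _.
  by rewrite indicT.
have f1 x : D x -> (1%E : \bar R) \is a fin_num by [].
have hlim := @dominated_cvg _ _ _ mu D mD _ _ (fun=> 1%E) ms hcvg f1 i1 sle.
have Es n : (\int[mu]_(x in D) (s n x)%:E)%E = (\sum_(0 <= k < n) phi k * fine (mu (A k)))%:E.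
  transitivity (\int[mu]_(x in D) \sum_(0 <= k < n) ((phi k)%:E * (\1_(A k) x)%:E))%E.
    by apply: eq_integral => x _; rewrite -sumEFin; apply: eq_bigr => k _; rewrite EFinM.
  rewrite integral_sum //; last first.
    by move=> k; apply: (integrableZl mD); exact: integrable_indic_in.
  rewrite -sumEFin; apply: eq_bigr => k _.
  rewrite integralZl //; last exact: integrable_indic_in.
  rewrite integral_indic // setIidl // EFinM fineK //.
  rewrite ge0_fin_numE ?measure_ge0 //; apply: le_lt_trans (_ : (mu D < +oo)%E).
    by apply: le_measure; rewrite ?inE.
  by rewrite mu1 ltry.
rewrite /Rintegral; have : (fun n => \int[mu]_(x in D) (s n x)%:E)%E @ \oo --> l%:E.
  by under eq_fun do rewrite Es; apply: cvg_EFin => //; near=> n.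
by move/(cvg_unique (@ereal_hausdorff R) hlim) => ->.
Unshelve. all: by end_near.
Qed.

End DiscreteIntegral.

Section ZetaFromSeries.
Variables (K : fieldType) (v : K -> \bar int).
Hypothesis hv : normalized_valuation v.
Variables (R : realType) (q n : nat).
Variable mu : {measure set (borel_affine v n) -> \bar R}.
Variable f : 'rV[K]_n -> K.
Hypothesis q_gt1 : (1 < q)%N.
Hypothesis mu1 : mu (int_points v n) = 1%E.
Hypothesis fint : forall x, intset v x -> vdvd v 0 (f x).
Hypothesis fmeas : forall k : nat,
  measurable (int_points v n `&` [set x | v (f x) = (k%:Z)%:E] : set (borel_affine v n)).

Lemma igusa_zeta_isP (Z : R[i] -> R[i]) :
  (forall t, cmod t < 1 -> Clim (psum (igusa_vol mu f) t) (Z t)) -> igusa_zeta_is q mu f Z.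
Proof.
move=> hZ; split; last by move=> t /cmod_lt1 /hZ /Clim_cvg.
move=> s s0; have q1 : 1 < q%:R :> R by rewrite ltr1n.
have q0 : 0 < q%:R :> R by lra.
set t := cpow q%:R (- s); have t1 : cmod t < 1 by exact: cmod_cpow.
have mD : measurable (int_points v n).
  by apply: (@locset_measurable _ _ _ 0); exact: locset_int.
(* P stands for the real or the imaginary part: all that matters is that it is real-linear and
   bounded by the modulus. *)
have part (P : R[i] -> R) : (forall x y, P (x - y) = P x - P y) ->
    (forall a x, P (a%:C * x) = a * P x) -> (forall x, `|P x| <= cmod x) ->
    Rintegral mu (int_points v n) (fun x => P (cpow (vabs R v q (f x)) s)) = P (Z t).
  move=> PB PZ Ple.
  have P0 : P 0 = 0 by rewrite -(subrr 0) PB subrr.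
  have PN x : P (- x) = - P x by rewrite -sub0r PB P0 sub0r.
  have PS (I : Type) (r : seq I) (E : I -> R[i]) : P (\sum_(i <- r) E i) = \sum_(i <- r) P (E i).
    elim: r => [|i r IH]; first by rewrite !big_nil P0.
    by rewrite !big_cons -IH -[X in P (_ + X)]opprK PB PN opprK.
  apply: (@Rintegral_discrete _ _ _ mu _ mD mu1
    (fun k => int_points v n `&` [set x | v (f x) = (k%:Z)%:E]) (fun k => P (t ^+ k))) => //.
  - by move=> j k x [_ /= ->] [_ /= []].
  - move=> k; apply: le_trans (Ple _) _.
    by rewrite cmodX exprn_ile1 ?cmod_ge0 // ltW.
  - move=> k x [_ /= Ex]; rewrite /vabs Ex; congr P.
    by rewrite /t -cpow_expV // exprnN.
  - move=> x ix hx; have [fx0|fx0] := eqVneq (f x) 0.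
      by rewrite fx0 /vabs (valuation0 hv) /cpow eqxx.
    by have [k Ek] := val_nat_or0 hv (fint ix) fx0; case: (hx k).
  - have := Clim_real PB Ple (hZ t t1); under eq_fun do rewrite /psum PS.
    under eq_fun do under eq_bigr do rewrite PZ /igusa_vol mulrC.
    by [].
rewrite /igusa_zeta !part; first by case: (Z t).
- exact: Im_sub.
- by move=> a [b c] /=; rewrite mul0r addr0.
- exact: Im_le_cmod.
- exact: Re_sub.
- by move=> a [b c] /=; rewrite mul0r subr0.
- exact: Re_le_cmod.
Qed.

End ZetaFromSeries.

(** * Zeta functions of diagonal polynomials *)

Section DensityGeneratingFunction.
Variables (K : fieldType) (v : K -> \bar int).
Hypothesis hv : normalized_valuation v.
Hypothesis hcomplete : valuation_complete v.
Hypothesis h2 : v 2%:R = 0%:E.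
Variables (F : finFieldType) (red : K -> F).
Hypothesis hred : residue_map v red.
Variable R : realType.

Lemma ltval_vdvd a : (0 < v a)%E = vdvd v 1 a.
Proof.
by rewrite /vdvd; case: (v a) => [b| |] //; rewrite ?leey ?ltey // lte_fin lee_fin; lia.
Qed.

(** The left side is the generating function of [smooth_density], a constant term plus a geometric
    tail. The factor w^2 allows for the change of discriminant under diagonalisation, which the
    quadratic character ignores. *)
Lemma density_I_int n (alpha : 'I_n -> K) (gamma d : K) (w : F) (t : R[i]) :
  vdvd v 0 gamma -> vdvd v 0 d -> w != 0 ->
  diag_disc (fun i => red (alpha i)) = red d * w ^+ 2 ->
  1 - t / #|F|%:R != 0 ->
  (smooth_density red R alpha gamma 0)%:C
  + (zero_density red R alpha gamma * (1 - #|F|%:R^-1))%:C * t / (1 - t / #|F|%:R)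
  = I_int v #|F| gamma (active_rank red alpha) d t.
Proof.
move=> ig id w0 Ed qt; set r := active_rank red alpha.
have h2F := red2_neq0 hv hred h2.
have dd0 : diag_disc (fun i => red (alpha i)) != 0 by apply/prodf_neq0.
have rd0 : red d != 0 by move: dd0; rewrite Ed mulf_eq0 negb_or => /andP[].
have chid (x : F) : quadratic_char (x * diag_disc (fun i => red (alpha i))) = quadratic_char (x * red d).
  by rewrite Ed mulrA chi_sqrM.
have inN k : vdvd v 0 ((-1) ^+ k).
  by apply: (vdvdX hv); rewrite (vdvdN hv) (vdvd1 hv).
have rN k : red ((-1) ^+ k) = (-1) ^+ k.
  by rewrite (redX hv hred) ?(vdvdN hv) ?(vdvd1 hv) // (redN hv hred) ?(vdvd1 hv) // (red1 hred).
have Q0 : #|F|%:R != 0 :> R[i] by exact: card_neq0.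
have QtB : #|F|%:R - t != 0.
  apply: contra_neq qt => e; rewrite (_ : t = #|F|%:R) ?divff ?subrr //.
  by apply/esym/eqP; rewrite -subr_eq0 e.
have Q1 : (#|F|%:R)%:C = #|F|%:R :> R[i] by rewrite rmorph_nat.
rewrite /I_int ltval_vdvd -(red_eq0 hred ig) /smooth_density /zero_density -/r /quad_density_formula /rho.
rewrite !(eta_red hv hcomplete hred h2); last 2 first.
- by rewrite (vdvdMl hv).
- by rewrite !(vdvdMl hv).
rewrite !(redM' hred) ?(vdvdMl hv) // !rN chid.
have [ro|ro] := boolP (odd r).
  pose m := r./2.
  have Er : r = (m + m).+1 by rewrite -[LHS]odd_double_half ro addnn add1n.
  have -> : r.+1./2 = m.+1 by rewrite /m; lia.
  rewrite -/m; set Qm := (#|F|%:R : R[i]) ^+ m.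
  have Qm0 : Qm != 0 by rewrite expf_neq0.
  have EQr : (#|F|%:R : R[i]) ^+ r = #|F|%:R * Qm * Qm by rewrite Er exprS exprD mulrA.
  have EQm : (#|F|%:R : R[i]) ^+ m.+1 = #|F|%:R * Qm by rewrite exprS.
  case: eqP => [->|/eqP g0].
    rewrite oppr0 chi0 mul0r mul0r addr0 mul1r.
    rewrite !(rmorphB, rmorphM, rmorphD, fmorphV, rmorphXn, rmorph1, rmorph_nat) /= EQr.
    by field; rewrite Q0 QtB Qm0.
  rewrite mul0r subr0.
  (* The equation solved is form = - gamma; its sign raises the exponent of -1 from (r-1)/2 to
     (r+1)/2. *)
  have -> : (quadratic_char (- red gamma))%:~R * (quadratic_char ((-1) ^+ m * red d))%:~R =
            (quadratic_char (red gamma * (-1) ^+ m.+1 * red d))%:~R :> R.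
    by rewrite -intrM -(chiM h2F); congr (_ *~ quadratic_char _); rewrite exprS; ring.
  rewrite !(rmorphB, rmorphM, rmorphD, fmorphV, rmorphXn, rmorph1, rmorph_nat, rmorph_int) /= EQr EQm.
  by field; rewrite Q0 QtB Qm0.
pose m := r./2.
have Er : r = (m + m)%N by rewrite -[LHS]odd_double_half (negPf ro) addnn.
rewrite -/m; set Qm := (#|F|%:R : R[i]) ^+ m.
have Qm0 : Qm != 0 by rewrite expf_neq0.
have EQr : (#|F|%:R : R[i]) ^+ r = Qm * Qm by rewrite Er exprD.
have : (-1) ^+ m * red d != 0 by rewrite mulf_neq0 // expf_neq0 // oppr_eq0 oner_eq0.
(* The identity uses that the character squares to 1, so its two values are substituted before
   [field]. *)
move=> /chi_cases hchi; case: (eqVneq (red gamma) 0) => [->|g0]; case: hchi => ->;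
  rewrite ?oppr0 ?eqxx ?oppr_eq0 ?(negPf g0);
  rewrite !(rmorphB, rmorphM, rmorphD, rmorphN, fmorphV, rmorphXn, rmorph1, rmorph0,
    rmorph_nat, rmorph_int) /= EQr -/Qm;
  by field; rewrite Q0 QtB Qm0.
Qed.

Lemma psum_density n (alpha : 'I_n -> K) (gamma d : K) (w : F) (t : R[i]) (V : R) j :
  vdvd v 0 gamma -> vdvd v 0 d -> w != 0 ->
  diag_disc (fun i => red (alpha i)) = red d * w ^+ 2 -> cmod t < 1 ->
  Clim (psum (fun k => if (j <= k)%N then V * smooth_density red R alpha gamma (k - j) else 0) t)
    (t ^+ j * (V%:C * I_int v #|F| gamma (active_rank red alpha) d t)).
Proof.
move=> ig id w0 Ed t1; have q0 : (0 < #|F|)%N by apply/card_gt0P; exists 0.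
apply: (@psum_shift R (fun k => V * smooth_density red R alpha gamma k) t _ j).
have qt : 1 - t / #|F|%:R != 0 by exact/sub1_neq0/cmod_div_nat.
rewrite -(density_I_int ig id w0 Ed qt).
have := @psum_geom R #|F| (fun k => V * smooth_density red R alpha gamma k) _
  (V * (zero_density red R alpha gamma * (1 - #|F|%:R^-1))) t q0 t1 erefl.
move=> H.
have -> : V%:C * ((smooth_density red R alpha gamma 0)%:C
   + (zero_density red R alpha gamma * (1 - #|F|%:R^-1))%:C * t / (1 - t / #|F|%:R))
   = (V * smooth_density red R alpha gamma 0)%:C
   + (V * (zero_density red R alpha gamma * (1 - #|F|%:R^-1)))%:C * t / (1 - t / #|F|%:R).
  by rewrite !(rmorphM _ V) /=; ring.
by apply: H => m /=; ring.
Qed.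

End DensityGeneratingFunction.

Lemma det_size0 (K : fieldType) k (A : 'M[K]_k) : k = 0%N -> \det A = 1.
Proof. by case: k A => // A _; exact: det_mx00. Qed.

Lemma rk_uptoSS (r : nat -> nat) j : rk_upto r j.+2 = (rk_upto r j + r j.+2)%N.
Proof.
rewrite /rk_upto [LHS]big_mkcond big_nat_recr //= big_nat_recr //= eqxx.
have -> : (j.+1 == j.+2 %[mod 2])%N = false by rewrite !modn2 /=; case: (odd j).
rewrite addn0 -big_mkcond; congr (_ + _)%N.
Qed.

Lemma disc_uptoSS (K : fieldType) (r : nat -> nat) (M : forall i : nat, 'M[K]_(r i)) j :
  disc_upto M j.+2 = disc_upto M j * \det (M j.+2).
Proof.
rewrite /disc_upto [LHS]big_mkcond big_nat_recr //= big_nat_recr //= eqxx.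
have -> : (j.+1 == j.+2 %[mod 2])%N = false by rewrite !modn2 /=; case: (odd j).
rewrite mulr1 -big_mkcond; congr (_ * _).
Qed.

(** The parity classes of j and j + 1 together exhaust the indices up to j + 1. *)
Lemma rk_upto_pair (r : nat -> nat) j :
  (rk_upto r j + rk_upto r j.+1 = \sum_(0 <= i < j.+2) r i)%N.
Proof.
elim: j => [|j IH].
  by rewrite /rk_upto unlock /= !addn0.
by rewrite rk_uptoSS addnA [X in (X + _)%N]addnC IH [RHS]big_nat_recr.
Qed.

(** * Summation of the shells in the three cases *)

Section DiagonalZeta.
Variables (K : fieldType) (v : K -> \bar int).
Hypothesis hv : normalized_valuation v.
Hypothesis hcomplete : valuation_complete v.
Hypothesis h2 : v 2%:R = 0%:E.
Variable pi : K.
Hypothesis hpi : v pi = 1%:E.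
Variables (F : finFieldType) (red : K -> F).
Hypothesis hred : residue_map v red.
Variables (n : nat) (R : realType).
Variable mu : {measure set (borel_affine v n) -> \bar R}.
Hypothesis tmu : tinv mu.
Hypothesis mu1 : mu (intset v (n := n)) = 1%E.
Variables (e : 'I_n -> nat) (u b : 'I_n -> K) (c : K).
Hypothesis hu : forall i, u i = 0 \/ v (u i) = 0%:E.
Hypothesis hub : forall i, u i != 0 -> b i = 0.
Variables (r : nat -> nat) (M : forall i : nat, 'M[K]_(r i)).
Local Notation alpha := (lvl_alpha pi e u).
Hypothesis hrank : forall j, lvl_rank pi red e u j = rk_upto r j.
Hypothesis idisc : forall j, vdvd v 0 (disc_upto M j).
Hypothesis hdisc : forall j, exists2 w, w != 0 &
  diag_disc (fun i => red (alpha j i)) = red (disc_upto M j) * w ^+ 2.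
Local Notation q := #|F|.
Local Notation form := (lvl_form pi e u b c).
Local Notation gvol := (lvl_vol pi red R e u).
Local Notation dens := (lvl_density pi red R e u c).
Local Notation term := (I_term v q M).
Variable t : R[i].
Hypothesis t1 : cmod t < 1.

Definition dvol k : R := fine (mu (intset v (n := n) `&` [set x | v (form 0%N x) = (k%:Z)%:E])).

Lemma gvolE j : gvol j = ((q_upto q r j)%:R)^-1.
Proof.
rewrite /lvl_vol /q_upto natrX big_mkord -prodrXr -prodfV.
by apply: eq_bigr => i _; rewrite hrank.
Qed.

Lemma q_gt0 : (0 < q)%N. Proof. by apply/card_gt0P; exists 0. Qed.

Lemma gvol_le1 j : gvol j <= 1.
Proof.
by rewrite gvolE invf_le1 ?ltr0n ?ler1n ?expn_gt0 ?q_gt0.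
Qed.

Lemma termE a i : term a i t =
  t ^+ i * ((gvol i)%:C * I_int v q a (lvl_rank pi red e u i) (disc_upto M i) t).
Proof. by rewrite /I_term hrank gvolE fmorphV rmorph_nat; ring. Qed.

Lemma I_int_nonunit a rr d : (0 < v a)%E -> I_int v q a rr d t = I_int v q 0 rr d t.
Proof. by move=> ha; rewrite /I_int ha (valuation0 hv) ltey. Qed.

Let sh i k : R := if (i <= k)%N then gvol i * dens i (k - i) else 0.

Lemma Clim_shell i : vdvd v i c -> Clim (psum (sh i) t) (term (c / pi ^+ i) i t).
Proof.
move=> hc; have [w w0 Ew] := hdisc i.
have ig : vdvd v 0 (lvl_gamma pi c i) by rewrite /lvl_gamma -(vdvd_piV hv hpi) addn0.
rewrite termE.
exact: (@psum_density _ _ hv hcomplete h2 _ _ hred _ _ _ _ _ _ _ _ _ ig (idisc i) w0 Ew t1).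
Qed.

Lemma dvol_decomp J : (forall i, vdvd v J (b i)) -> vdvd v J c ->
  exists nu : {measure set (borel_affine v n) -> \bar R},
  [/\ tinv nu, nu (intset v (n := n)) = (gvol J)%:E,
    forall k : nat, 0 <= fine (nu (intset v (n := n) `&` [set x | v (form J x) = (k%:Z)%:E])) <= gvol J
    & forall k, dvol k = \sum_(i < J) sh i k + (if (J <= k)%N then
      fine (nu (intset v (n := n) `&` [set x | v (form J x) = (Posz (k - J))%:E])) else 0)].
Proof.
move=> hb hc; have [nu [tnu nuV Enu]] := shell_decomposition hv h2 hpi hred e hu hub tmu mu1 hb hc.
have ia := int_alpha hv hpi e hu J.
have ib i : vdvd v 0 (lvl_beta pi b J i) by rewrite /lvl_beta -(vdvd_piV hv hpi) addn0.
have hlip := @dquad_lip _ _ hv _ _ _ (lvl_gamma pi c J) ia ib.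
have le k : (nu (intset v (n := n) `&` [set x | v (form J x) = (Posz k)%:E]) <= (gvol J)%:E)%E.
  rewrite -nuV; apply: le_measure; rewrite ?inE.
  - by apply: (@locset_measurable _ _ _ k.+1); exact: locset_val.
  - by apply: (@locset_measurable _ _ _ 0); exact: locset_int.
  - by move=> x [].
have fn k : nu (intset v (n := n) `&` [set x | v (form J x) = (Posz k)%:E]) \is a fin_num.
  by rewrite ge0_fin_numE ?measure_ge0 //; apply: le_lt_trans (le k) (ltry _).
exists nu; split => //.
  move=> k; rewrite fine_ge0 ?measure_ge0 //= -lee_fin fineK //.
move=> k; rewrite /dvol Enu; case: ifP => _; last by rewrite adde0 addr0.
by rewrite fineD.
Qed.

Lemma Clim_remainder J (rem : nat -> R) S :
  (forall i, (i < J)%N -> vdvd v i c) ->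
  (forall k, dvol k = \sum_(i < J) sh i k + rem k) -> Clim (psum rem t) S ->
  Clim (psum dvol t) (\sum_(0 <= i < J) term (c / pi ^+ i) i t + S).
Proof.
move=> hc E hS; rewrite big_mkord.
have hsh : Clim (fun N => \sum_(i < J) psum (sh i) t N) (\sum_(i < J) term (c / pi ^+ i) i t).
  by apply: (@Clim_sum R _ _ (fun i : 'I_J => psum (sh i) t)) => i; exact/Clim_shell/hc.
apply: Clim_ext (ClimD hsh hS) => N; rewrite -psum_sum -psumD /psum.
by apply: eq_bigr => k _; rewrite E.
Qed.

(** After l steps the coefficient of x_i is a unit and [measure_linear] evaluates all that is left.
    For j < l the constant c / pi^j is a nonunit, so I_a may be replaced by I_0. *)
Lemma zeta_linear (i : 'I_n) l : u i = 0 -> v (b i) = (l%:Z)%:E ->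
  (forall j, vdvd v l (b j)) -> vdvd v l c ->
  Clim (psum dvol t) (\sum_(0 <= i < l) term 0 i t
    + t ^+ l / (q_upto q r l)%:R * ((1 - 1 / q%:R) / (1 - t / q%:R))).
Proof.
move=> ui vb hb hc; have [nu [tnu nuV _ E]] := dvol_decomp hb hc.
have ia := int_alpha hv hpi e hu l.
have ib j : vdvd v 0 (lvl_beta pi b l j) by rewrite /lvl_beta -(vdvd_piV hv hpi) addn0.
have ig : vdvd v 0 (lvl_gamma pi c l) by rewrite /lvl_gamma -(vdvd_piV hv hpi) addn0.
pose s m : R := gvol l * (1 - q%:R^-1) / q%:R ^+ m.
have Es m : fine (nu (intset v (n := n) `&` [set x | v (form l x) = (Posz m)%:E])) = s m.
  rewrite (measure_linear hv hpi hred tnu nuV ia ib ig (i := i)) //.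
    by rewrite /lvl_alpha ui mul0r.
  apply/(val_unitE (ib i)); rewrite /lvl_beta -(vdvd_piV hv hpi) addn1.
  by move/val_eq_nat: vb => /andP[].
rewrite (@eq_big_nat _ _ _ 0 l _ (fun i => term (c / pi ^+ i) i t)); last first.
  move=> j /andP[_ jl]; rewrite /I_term -(@I_int_nonunit (c / pi ^+ j)) //.
  rewrite ltval_vdvd -(vdvd_piV hv hpi); apply: vdvdW hc; lia.
apply: (Clim_remainder _ E) => [j jl|]; first by apply: vdvdW hc; lia.
have q0 : q%:R != 0 :> R by rewrite pnatr_eq0 -lt0n q_gt0.
have qC0 : q%:R != 0 :> R[i] by rewrite pnatr_eq0 -lt0n q_gt0.
have sS m : s m.+1 = gvol l * (1 - q%:R^-1) / q%:R / q%:R ^+ m.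
  by rewrite /s exprS; field; rewrite q0 expf_neq0.
have := @psum_geom R q s _ _ t q_gt0 t1 erefl sS.
have qt : 1 - t / q%:R != 0 by exact/sub1_neq0/(cmod_div_nat q_gt0).
move/(@psum_shift R s t _ l).
have -> : t ^+ l * ((s 0%N)%:C + (gvol l * (1 - q%:R^-1) / q%:R)%:C * t / (1 - t / q%:R)) =
   t ^+ l / (q_upto q r l)%:R * ((1 - 1 / q%:R) / (1 - t / q%:R)).
  rewrite /s expr0 divr1 gvolE.
  rewrite !(rmorphM, rmorphB, fmorphV, rmorph_nat, rmorph1) /=.
  have qt' : q%:R - t != 0.
    apply: contra_neq qt => e0; rewrite (_ : t = q%:R) ?divff ?subrr //.
    by apply/esym/eqP; rewrite -subr_eq0 e0.
  have qu : (q_upto q r l)%:R != 0 :> R[i] by rewrite pnatr_eq0 -lt0n expn_gt0 q_gt0.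
  by field; rewrite qC0 qt' qu.
apply: Clim_ext => N; rewrite /psum; apply: eq_bigr => k _.
by case: ifP => // _; rewrite Es.
Qed.

(** After k steps the constant is a unit. By [last_level] this leaves the shell k and its singular
    points, which have total volume 1/q_(k+1) and on which the original form has valuation exactly
    k. *)
Lemma zeta_const k : v c = (k%:Z)%:E -> (forall j, vdvd v k.+1 (b j)) ->
  Clim (psum dvol t) (\sum_(0 <= i < k.+1) term (c / pi ^+ i) i t
    + t ^+ k / (q_upto q r k.+1)%:R).
Proof.
move=> vc hb; have hc : vdvd v k c by rewrite /vdvd vc.
have hb' i : vdvd v k (b i) by apply: vdvdW (hb i).
have [nu [tnu nuV _ E]] := dvol_decomp hb' hc.
pose s m : R := if m == 0%N then gvol k.+1 else 0.
pose rem k' : R := if (k <= k')%N then s (k' - k)%N else 0.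
apply: (@Clim_remainder k.+1 rem).
- by move=> i ik; apply: vdvdW hc.
- move=> k'; rewrite E big_ord_recr /= -addrA /rem /sh; congr (_ + _).
  case: ifP => _; last by rewrite addr0.
  rewrite (last_level hv h2 hpi hred e hu tnu nuV hb vc) /s /=; congr (_ + _).
  by case: ifP => // _; rewrite /lvl_vol big_ord_recr.
have sS m : s m.+1 = 0 / q%:R ^+ m by rewrite mul0r.
have := @psum_geom R q s _ _ t q_gt0 t1 erefl sS.
have -> : (q_upto q r k.+1)%:R^-1 = (s 0%N)%:C by rewrite /s /= gvolE fmorphV rmorph_nat.
move/(@psum_shift R s t _ k); rewrite mul0r mul0r addr0.
by apply: Clim_ext => N.
Qed.

Lemma zeta_homogeneous w : (0 < w)%N -> (forall i, (w < i)%N -> r i = 0%N) ->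
  (forall j, b j = 0) -> c = 0 ->
  Clim (psum dvol t) (\sum_(0 <= i < w.-1) term 0 i t
    + (term 0 w.-1 t + term 0 w t) * (1 - t ^+ 2 / q%:R ^+ (\sum_(0 <= i < w.+1) r i)%N)^-1).
Proof.
move=> w0 hw hb c0; set x := t ^+ 2 / _.
have hc i : vdvd v i c by rewrite c0 (vdvd0 hv).
have hc0 i : c / pi ^+ i = 0 by rewrite c0 mul0r.
have x1 : cmod x < 1.
  rewrite /x cmodM cmodX cmodV -(rmorph_nat (real_complex R)) -rmorphXn cmodR /=.
  rewrite normrX normr_nat; have t0 := cmod_ge0 t.
  apply: (@le_lt_trans _ _ (cmod t ^+ 2)); last by rewrite expr_lt1.
  rewrite ler_piMr ?exprn_ge0 // invf_le1 ?exprn_gt0 ?ltr0n ?q_gt0 //.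
  by rewrite exprn_ege1 // ler1n q_gt0.
(* Block i + 2 is empty, so rank and discriminant repeat, while q_(i+2) gains q to the power r_(i) +
   r_(i+1), which is the full rank. *)
have termSS i : (w <= i.+1)%N -> term 0 i.+2 t = x * term 0 i t.
  move=> wi; rewrite /I_term.
  have ri : r i.+2 = 0%N by apply: hw; lia.
  rewrite rk_uptoSS ri addn0 disc_uptoSS (det_size0 _ ri) mulr1.
  have -> : q_upto q r i.+2 = (q_upto q r i * q ^ (\sum_(0 <= i < w.+1) r i))%N.
    have E : (\sum_(0 <= k < i.+2) rk_upto r k =
        \sum_(0 <= k < i) rk_upto r k + (rk_upto r i + rk_upto r i.+1))%N.
      by rewrite !big_nat_recr //= addnA.
    rewrite /q_upto E rk_upto_pair expnD; congr (_ * q ^ _)%N.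
    rewrite (@big_cat_nat _ _ _ w.+1) //= [X in (_ + X)%N]big1_seq ?addn0 // => j /=.
    by rewrite mem_index_iota => /andP[hj _]; apply: hw.
  by rewrite natrM natrX /x invfM !exprS; ring.
have pair k : \sum_(0 <= i < w.-1 + k.*2) term 0 i t =
   \sum_(0 <= i < w.-1) term 0 i t + (term 0 w.-1 t + term 0 w t) * \sum_(0 <= i < k) x ^+ i.
  have term_iter a m : (w.-1 <= a)%N -> term 0 (a + m.*2) t = x ^+ m * term 0 a t.
    move=> wa; elim: m => [|m IH]; first by rewrite addn0 expr0 mul1r.
    by rewrite doubleS !addnS termSS ?IH ?exprS ?mulrA //; lia.
  elim: k => [|k IH]; first by rewrite addn0 [X in _ * X]big_geq // mulr0 addr0.
  rewrite doubleS !addnS !big_nat_recr //= IH -addSn prednK //.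
  rewrite term_iter // term_iter ?leq_pred //; ring.
apply: (@Clim_shells R dvol sh (fun i => term 0 i t)) => //.
- by move=> i; have := Clim_shell (hc i); rewrite hc0.
- move=> J; have [||nu [tnu nuV le E]] := @dvol_decomp J; [by move=> i; rewrite hb (vdvd0 hv)|exact: hc|].
  have Er k : dvol k - \sum_(i < J) sh i k = if (J <= k)%N then
      fine (nu (intset v (n := n) `&` [set x | v (form J x) = (Posz (k - J))%:E])) else 0.
    by rewrite E addrAC subrr add0r.
  exists (fun k => dvol k - \sum_(i < J) sh i k); split => [k|k|k kJ].
  - by rewrite addrC subrK.
  - rewrite Er; case: ifP => _; last by rewrite normr0.
    have /andP[h1 h3] := le (k - J)%N; rewrite ger0_norm //.
    exact: le_trans h3 (gvol_le1 J).
  - by rewrite Er ifN // -ltnNge.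
move=> eps e0 J0.
have := ClimM (term 0 w.-1 t + term 0 w t) (Clim_geom x1).
(* Only truncations that end with a complete pair of shells are compared with the closed form. *)
move=> /(_ _ e0) [N hN]; pose k := maxn N J0; exists (w.-1 + k.*2)%N; first by rewrite /k; lia.
have := hN k (leq_maxl _ _); rewrite -(big_mkord xpredT (fun i => term 0 i t)) pair.
by rewrite opprD addrACA subrr add0r.
Qed.

End DiagonalZeta.

(** * Reduction to diagonal polynomials *)

Lemma big_tagnat (T : Type) (idx : T) (op : Monoid.com_law idx) k (p : 'I_k -> nat)
  (G : {i : 'I_k & 'I_(p i)} -> T) :
  \big[op/idx]_(s < (\sum_i p i)%N) G (tagnat.sig s) =
  \big[op/idx]_(i < k) \big[op/idx]_(l < p i) G (@Tagged _ i (fun i => 'I_(p i)) l).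
Proof.
rewrite (sig_big_dep _ _ (fun i l => G (@Tagged _ i (fun i => 'I_(p i)) l))) /=.
rewrite (reindex _ (@tagnat.sig_bij_on k p)) /=.
by apply: eq_bigr => s _; case: (tagnat.sig s).
Qed.

(** The blocks active at step j are those i <= j of the parity of j. The two ranges, up to w and up
    to j, are compared inside the range up to their maximum: blocks beyond w are trivial, and blocks
    beyond j are inactive. *)
Lemma big_parity_blocks (T : Type) (idx : T) (op : Monoid.com_law idx) (w j : nat) (E : nat -> T) :
  (forall i, (w < i)%N -> E i = idx) ->
  \big[op/idx]_(i < w.+1 | level_exp i j == 0%N) E i =
  \big[op/idx]_(0 <= i < j.+1 | (i == j %[mod 2])%N) E i.
Proof.
move=> Ew; have H a : (j < a)%N -> (w < a)%N ->
    \big[op/idx]_(0 <= i < a | level_exp i j == 0%N) E i =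
    \big[op/idx]_(0 <= i < j.+1 | (i == j %[mod 2])%N) E i.
  move=> ja wa; rewrite (@big_cat_nat _ _ _ j.+1) //= [X in op _ X]big1_seq ?Monoid.mulm1; last first.
    by move=> i /=; rewrite mem_index_iota level_exp_eq0 => h; lia.
  rewrite big_seq_cond [RHS]big_seq_cond; apply: eq_bigl => i.
  rewrite mem_index_iota level_exp_eq0; case: (ltnP i j.+1) => h; rewrite ?andbF //=.
  by rewrite -ltnS h.
rewrite -(H (maxn j w).+1) ?ltnS ?leq_maxl ?leq_maxr //.
rewrite (@big_cat_nat _ _ _ w.+1) ?ltnS ?leq_maxr //= [X in op _ X]big1_seq ?Monoid.mulm1 ?big_mkord //.
by move=> i /andP[_]; rewrite mem_index_iota => h; apply: Ew; lia.
Qed.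

Section Blocks.
Variables (K : fieldType) (v : K -> \bar int).
Hypothesis hv : normalized_valuation v.
Variable pi : K.
Hypothesis hpi : v pi = 1%:E.
Variables (F : finFieldType) (red : K -> F).
Hypothesis hred : residue_map v red.
Variables (w : nat) (r : nat -> nat) (M : forall i : nat, 'M[K]_(r i)).
Hypothesis hM : forall i : nat, unimodular v (M i).
Hypothesis hw : forall i : nat, (w < i)%N -> r i = 0%N.
Variables (m : nat) (L : 'cV[K]_m) (c : K).
Local Notation n := (\sum_(i < w.+1) r i + m)%N.

Variables (P P' : forall i : nat, 'M[K]_(r i)) (u : forall i : nat, 'rV[K]_(r i)).
Hypothesis hD : forall i, [/\ imx v (P i), imx v (P' i), P i *m P' i = 1%:M,
  P i *m M i *m (P i)^T = diag_mx (u i) & forall k, v (u i 0 k) = 0%:E].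

(** On the last m coordinates the exponent 0 is a dummy: [blk_unit] is 0 there, so they never become
    active. *)
Definition blk_exp (s : 'I_n) : nat :=
  match fintype.split s with inl s => tagnat.sig1 s | inr _ => 0%N end.
Definition blk_unit (s : 'I_n) : K :=
  match fintype.split s with inl s => u (tagnat.sig1 s) 0 (tagnat.sig2 s) | inr _ => 0 end.
Definition blk_lin (s : 'I_n) : K :=
  match fintype.split s with inl _ => 0 | inr k => L k ord0 end.

Definition blk_mx : 'M[K]_n := block_mx (\mxdiag_(i < w.+1) P i) 0 0 1%:M.
Definition blk_inv : 'M[K]_n := block_mx (\mxdiag_(i < w.+1) P' i) 0 0 1%:M.

Lemma imx_diag (B : forall i : nat, 'M[K]_(r i)) : (forall i, imx v (B i)) ->
  imx v (\mxdiag_(i < w.+1) B i).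
Proof.
move=> hB i j; rewrite !mxE; case: eqP => [e|_]; last by rewrite mxE (vdvd0 hv).
by move: (tagnat.sig2 j); rewrite -e => ?; rewrite conform_mx_id; exact: hB.
Qed.

Lemma mul_mxdiagE k (A : 'M[K]_(k, \sum_(i < w.+1) r i)) (B : forall i : nat, 'M[K]_(r i)) :
  A *m \mxdiag_(i < w.+1) B i = \mxrow_(i < w.+1) (submxrow A i *m B i).
Proof. by rewrite -[in LHS](submxrowK A) mul_mxrow_mxdiag. Qed.

Lemma blk_mxK : blk_mx *m blk_inv = 1%:M.
Proof.
rewrite /blk_mx /blk_inv mulmx_block !mul0mx !mulmx0 !mulmx1 !addr0 add0r.
suff -> : (\mxdiag_(i < w.+1) P i) *m (\mxdiag_(i < w.+1) P' i) = 1%:M.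
  by rewrite -scalar_mx_block.
rewrite -[X in X *m _]mul1mx !mul_mxdiagE -[RHS]submxrowK; apply/eq_mxrow => i.
by rewrite mxrowK -mulmxA; have [_ _ -> _ _] := hD i; rewrite mulmx1.
Qed.

Lemma imx_blk_mx : imx v blk_mx.
Proof.
apply: imx_block; [|exact: imx0|exact: imx0|exact: imx1].
by apply: imx_diag => i; have [] := hD i.
Qed.

Lemma imx_blk_inv : imx v blk_inv.
Proof.
apply: imx_block; [|exact: imx0|exact: imx0|exact: imx1].
by apply: imx_diag => i; have [] := hD i.
Qed.

Lemma quad_form_diag i (z : 'rV[K]_(r i)) :
  quad_form (M i) (z *m P i) = \sum_k u i 0 k * z 0 k ^+ 2.
Proof.
rewrite /quad_form trmx_mul !mulmxA; have [_ _ _ E _] := hD i.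
have -> : z *m P i *m M i *m (P i)^T *m z^T = z *m (P i *m M i *m (P i)^T) *m z^T.
  by rewrite !mulmxA.
rewrite E mxE; apply: eq_bigr => k _; rewrite mul_mx_diag !mxE; ring.
Qed.

Lemma direct_sum_polyE (y : 'rV[K]_n) :
  direct_sum_poly pi M L c (y *m blk_mx) = lvl_form pi blk_exp blk_unit blk_lin c 0 y.
Proof.
rewrite /direct_sum_poly /lvl_form /dquad /lvl_gamma expr0 divr1; congr (_ + _).
have -> : y *m blk_mx = row_mx (lsubmx y *m \mxdiag_(i < w.+1) P i) (rsubmx y).
  by rewrite -[in LHS](hsubmxK y) /blk_mx mul_row_block !mulmx0 mulmx1 addr0 add0r.
rewrite row_mxKl row_mxKr big_split_ord /=; congr (_ + _).
  rewrite mul_mxdiagE.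
  pose G (x : {i : 'I_w.+1 & 'I_(r i)}) : K :=
    u (tag x) 0 (tagged x) * pi ^+ tag x * y 0 (lshift m (tagnat.rank x)) ^+ 2.
  rewrite [RHS](eq_bigr (fun s => G (tagnat.sig s))); last first.
    move=> s _; rewrite /lvl_alpha /lvl_beta /blk_exp /blk_unit /blk_lin.
    rewrite (unsplitK (inl s)) mul0r mul0r addr0 /G tagnat.sigK /level_exp /= subn0.
    by [].
  rewrite big_tagnat; apply: eq_bigr => i _; rewrite mxrowK quad_form_diag mulr_sumr.
  by apply: eq_bigr => k _; rewrite /G /= !mxE; ring.
rewrite mxE; apply: eq_bigr => k _; rewrite /lvl_alpha /lvl_beta /blk_exp /blk_unit /blk_lin.
by rewrite (unsplitK (inr k)) mul0r mul0r add0r expr0 divr1 mxE mulrC.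
Qed.

Lemma blk_unit_val s : blk_unit s = 0 \/ v (blk_unit s) = 0%:E.
Proof.
rewrite /blk_unit; case: fintype.split => [k|k]; [right|by left].
by have [_ _ _ _ h] := hD (tagnat.sig1 k); exact: h.
Qed.

Lemma blk_unit_lin s : blk_unit s != 0 -> blk_lin s = 0.
Proof. by rewrite /blk_unit /blk_lin; case: fintype.split => // k; rewrite eqxx. Qed.

Lemma u_neq0 i k : u i 0 k != 0.
Proof. by have [_ _ _ _ h] := hD i; exact: unit_neq0 (h k). Qed.

Local Notation alpha := (lvl_alpha pi blk_exp blk_unit).

Lemma blk_rank j : lvl_rank pi red blk_exp blk_unit j = rk_upto r j.
Proof.
rewrite /lvl_rank /active_rank /diag_rank.
under eq_bigr do rewrite (red_alpha hv hpi hred _ blk_unit_val) /active /blk_unit /blk_exp.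
rewrite big_split_ord /= [X in (_ + X)%N]big1 => [|k _]; last first.
  by rewrite (unsplitK (inr k)) eqxx.
pose G (x : {i : 'I_w.+1 & 'I_(r i)}) : nat := level_exp (tag x) j == 0%N.
rewrite addn0 (eq_bigr (fun s => G (tagnat.sig s))); last first.
  by move=> s _; rewrite (unsplitK (inl s)) u_neq0.
rewrite big_tagnat /rk_upto -(@big_parity_blocks _ _ addn w j r hw) [RHS]big_mkcond.
apply: eq_bigr => i _; rewrite /G /= sum_nat_const card_ord.
by case: ifP => _; rewrite ?muln1 ?muln0.
Qed.

Lemma disc_unit j : v (disc_upto M j) = 0%:E.
Proof.
rewrite /disc_upto; elim/big_ind: _ => [|x y hx hy|i _]; first exact: valuation1.
- by rewrite (nvM hv) hx hy add0e.
- by have [] := hM i.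
Qed.

(** Block by block, the product of the diagonal units is det M_i times the square of det P_i; x is
    the product of the residues of det P_i over the active blocks. *)
Lemma blk_disc j : exists2 x : F, x != 0 &
  diag_disc (fun i => red (alpha j i)) = red (disc_upto M j) * x ^+ 2.
Proof.
have [PU iP] : (forall i, v (\det (P i)) = 0%:E) /\ (forall i, vdvd v 0 (\det (P i))).
  have iP i : vdvd v 0 (\det (P i)) by apply: (imx_det hv); have [] := hD i.
  split => // i; have [iPi iPi' /(congr1 determinant)] := hD i; rewrite det_mulmx det1 => e _ _.
  apply/(val_unitE (iP i))/negP => h.
  have h1 : ~~ vdvd v 1 1 by apply/(val_unitE (vdvd1 hv)); exact: (valuation1 hv).
  by case/negP: h1; rewrite -e; apply: (vdvdMl hv) => //; exact: (imx_det hv).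
have iM i : vdvd v 0 (\det (M i)) by have [_ _ /unit_vdvd] := hM i.
have Edet i : \prod_k u i 0 k = \det (M i) * \det (P i) ^+ 2.
  have [_ _ _ /(congr1 determinant) E _] := hD i; move: E.
  by rewrite det_diag !det_mulmx det_tr => <-; ring.
pose x := \prod_(i < w.+1 | level_exp i j == 0%N) red (\det (P i)).
exists x.
  by apply/prodf_neq0 => i _; apply/(red_neq0 hred).
rewrite /diag_disc big_mkcond.
pose G (z : {i : 'I_w.+1 & 'I_(r i)}) : F :=
  if level_exp (tag z) j == 0%N then red (u (tag z) 0 (tagged z)) else 1.
rewrite big_split_ord /= [X in _ * X]big1 ?mulr1 => [|k _]; last first.
  by rewrite (red_alpha hv hpi hred _ blk_unit_val) /active /blk_unit (unsplitK (inr k)) eqxx.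
rewrite (eq_bigr (fun s => G (tagnat.sig s))); last first.
  move=> s _; rewrite (red_alpha hv hpi hred _ blk_unit_val) /active /lvl_alpha /blk_unit /blk_exp.
  rewrite (unsplitK (inl s)) u_neq0 /= /G -/(tagnat.sig1 s) -/(tagnat.sig2 s).
  by case: eqP => // ->; rewrite expr0 mulr1.
rewrite big_tagnat /disc_upto (red_prod hv hred) //.
rewrite /x -prodrXl.
have -> : \prod_(0 <= i < j.+1 | (i == j %[mod 2])%N) red (\det (M i)) =
   \prod_(i < w.+1 | level_exp i j == 0%N) red (\det (M i)).
  apply/esym/(@big_parity_blocks _ _ *%R w j (fun i => red (\det (M i)))) => i wi.
  by rewrite det_size0 ?(red1 hred) // hw.
rewrite -big_split /= [RHS]big_mkcond; apply: eq_bigr => i _.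
rewrite /G /=; case: ifP => _; last by rewrite big1.
rewrite -(red_prod hv hred) ?Edet ?(redM' hred) ?(redX hv hred) ?(vdvdX hv) //.
by move=> k _; have [_ _ _ _ h] := hD i; exact: unit_vdvd.
Qed.

End Blocks.

Theorem theorem2p1 (R : realType) (p : nat) (p_prime : prime p) (p_odd : odd p)
  (Qp : fieldType) (vp : Qp -> \bar int) (K : fieldExtType Qp)
  (v : K -> \bar int) (hK : padic_field p vp v)
  (pi : K) (hpi : v pi = 1%:E)
  (F : finFieldType) (red : K -> F) (hred : residue_map v red)
  (w : nat) (w_gt0 : (0 < w)%N)
  (r : nat -> nat) (M : forall i : nat, 'M[K]_(r i))
  (hM : forall i : nat, unimodular v (M i))
  (hw : forall i : nat, (w < i)%N -> r i = 0%N)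
  (m : nat) (L : 'cV[K]_m) (hL : L \is a mxOver (valring v))
  (hL1 : forall i j : 'I_m, L i ord0 != 0 -> L j ord0 != 0 -> i = j)
  (c : K) (hc : c \in valring v)
  (mu : {measure set (borel_affine v (\sum_(i < w.+1) r i + m)) -> \bar R})
  (hmu : haar mu) :
  let q := #|F| in
  let Q := @direct_sum_poly K pi w r M m L c in
  [/\ (L = 0 -> c = 0 ->
       igusa_zeta_is q mu Q (fun t =>
         \sum_(0 <= i < w.-1) I_term v q M 0 i t
         + (I_term v q M 0 w.-1 t + I_term v q M 0 w t)
           * (1 - t ^+ 2 / q%:R ^+ (\sum_(0 <= i < w.+1) r i)%N)^-1)),
      (forall (j : 'I_m) (l : nat),
       v (L j ord0) = (l%:Z)%:E -> (v (L j ord0) <= v c)%E ->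
       igusa_zeta_is q mu Q (fun t =>
         \sum_(0 <= i < l) I_term v q M 0 i t
         + t ^+ l / (q_upto q r l)%:R
           * ((1 - 1 / q%:R) / (1 - t / q%:R))))
    & (forall k : nat,
       v c = (k%:Z)%:E -> (forall j : 'I_m, (v c < v (L j ord0))%E) ->
       igusa_zeta_is q mu Q (fun t =>
         \sum_(0 <= i < k.+1) I_term v q M (c / pi ^+ i) i t
         + t ^+ k / (q_upto q r k.+1)%:R))].
Proof.
move=> q Q.
have hv := pf_valuation hK; have hcomp := padic_field_complete hK.
have h2 := padic_field_val2 p_prime p_odd hK.
have [tmu mu1] := hmu.
have blk i : exists x : 'M[K]_(r i) * 'M[K]_(r i) * 'rV[K]_(r i),
    [/\ imx v x.1.1, imx v x.1.2, x.1.1 *m x.1.2 = 1%:M,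
        x.1.1 *m M i *m x.1.1^T = diag_mx x.2 & forall k, v (x.2 0 k) = 0%:E].
  have [symM /mxOverP iM dM] := hM i.
  by have [P [P' [u h]]] := unimodular_diag hv h2 symM iM dM; exists (P, P', u).
pose D i := projT1 (cid (blk i)).
pose P i := (D i).1.1; pose P' i := (D i).1.2; pose u i := (D i).2.
have hD i : [/\ imx v (P i), imx v (P' i), P i *m P' i = 1%:M,
    P i *m M i *m (P i)^T = diag_mx (u i) & forall k, v (u i 0 k) = 0%:E].
  by rewrite /P /P' /u /D; case: cid.
have TT' := @blk_mxK K v w r M m P P' u hD.
have iT := imx_blk_mx hv hD (w := w) (m := m).
have iT' := imx_blk_inv hv hD (w := w) (m := m).
have T'T := mulmx1C TT'.
set T := blk_mx w m P in TT' iT T'T; set T' := blk_inv w m P' in TT' iT' T'T.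
pose f := lvl_form pi (@blk_exp w r m) (@blk_unit K w r m u) (@blk_lin K w r m L) c 0.
have EQ x : Q x = f (x *m T').
  by rewrite /f -(direct_sum_polyE pi L c hD) -mulmxA T'T mulmx1.
have int_mul B x : imx v B -> intset v x -> intset v (x *m B).
  by move=> iB ix j; apply: (imxM hv _ iB) => a b; rewrite ord1; exact: ix.
have intT' x : intset v (x *m T') <-> intset v x.
  split; last exact: int_mul.
  by move=> /(int_mul _ _ _ _ iT); rewrite -mulmxA T'T mulmx1.
have hub := @blk_unit_lin K w r m L u.
have hu := @blk_unit_val K v w r M m P P' u hD.
have hrank := blk_rank hv hpi hred hw m hD.
have hdisc := blk_disc hv hpi hred hM hw m hD.
have idisc j := unit_vdvd (disc_unit hv hM j).
(* The diagonalising change of variables also acts on the measure. Since T and T' are both integral,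
   the integral points are preserved and keep mass 1. *)
have [nu tnu Enu] := pushforward_linear hv tmu TT'.
have nu1 : nu (intset v (n := \sum_(i < w.+1) r i + m)) = 1%E.
  by rewrite Enu -mu1; congr (mu _); apply/seteqP; split => x /intT'.
have ilin s : vdvd v 0 (@blk_lin K w r m L s).
  rewrite /blk_lin; case: fintype.split => [_|k]; first exact: vdvd0.
  by move/mxOverP: hL; exact.
have ia := int_alpha hv hpi (@blk_exp w r m) hu 0.
have ib i : vdvd v 0 (lvl_beta pi (@blk_lin K w r m L) 0 i).
  by rewrite /lvl_beta expr0 divr1.
have ig : vdvd v 0 (lvl_gamma pi c 0) by rewrite /lvl_gamma expr0 divr1.
(* Needed for Q itself, since its level sets have to be measurable in the original coordinates. *)
have hlip k x y : intset v x -> vcong v k x y -> vdvd v k (Q y - Q x).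
  move=> ix h; rewrite !EQ;
  apply: (@dquad_lip _ _ hv _ _ _ (lvl_gamma pi c 0) ia ib); first exact/intT'.
  move=> j; rewrite !mxE -sumrB; apply: (vdvd_sum hv) => l _.
  by rewrite -mulrBl; apply: (vdvdMl hv); [exact: h | exact: iT'].
have Evol k : igusa_vol mu Q k = dvol pi nu (@blk_exp w r m) (@blk_unit K w r m u)
    (@blk_lin K w r m L) c k.
  rewrite /igusa_vol /dvol Enu; congr (fine (mu _)); apply/seteqP; split => x /=.
    by move=> [ix hx]; split; [exact/intT' | rewrite -/f -EQ].
  by move=> [/intT' ix]; rewrite -/f -EQ.
have q_gt1 : (1 < q)%N by exact: card_finNzRing_gt1.
have main Z : (forall t, cmod t < 1 -> Clim (psum (dvol pi nu (@blk_exp w r m)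
    (@blk_unit K w r m u) (@blk_lin K w r m L) c) t) (Z t)) -> igusa_zeta_is q mu Q Z.
  move=> hZ; apply: (igusa_zeta_isP hv q_gt1 mu1).
  - by move=> x ix; rewrite EQ; apply: (dquad_int hv) => //; exact/intT'.
  - by move=> k; apply: (@locset_measurable _ _ _ k.+1); exact: (locset_val hv hlip).
  - move=> t t1; apply: Clim_ext (hZ t t1) => N; rewrite /psum.
    by apply: eq_bigr => k _; rewrite Evol.
split.
- move=> L0 c0; apply: main => t t1.
  apply: (zeta_homogeneous hv hcomp h2 hpi hred tnu nu1 hu hub hrank idisc hdisc t1) => //.
  by move=> s; rewrite /blk_lin; case: fintype.split => // k; rewrite L0 mxE.
- move=> j l vL vc; apply: main => t t1.
  have Lj : L j ord0 != 0 by apply/eqP => /(nv_infty hv); rewrite vL.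
  apply: (zeta_linear hv hcomp h2 hpi hred tnu nu1 hu hub hrank idisc hdisc t1 (i := rshift _ j)).
  + by rewrite /blk_unit (unsplitK (inr j)).
  + by rewrite /blk_lin (unsplitK (inr j)).
  + move=> s; rewrite /blk_lin; case: fintype.split => [_|k]; first exact: vdvd0.
    (* L involves at most one variable, so a nonzero coefficient can only be the j-th. *)
    have [->|Lk] := eqVneq (L k ord0) 0; first exact: vdvd0.
    by rewrite (hL1 _ _ Lk Lj) /vdvd vL.
  + by rewrite /vdvd -vL.
- move=> k vc vL; apply: main => t t1.
  apply: (zeta_const hv hcomp h2 hpi hred tnu nu1 hu hub hrank idisc hdisc t1 vc).
  move=> s; rewrite /blk_lin; case: fintype.split => [_|j]; first exact: vdvd0.
  by have := vL j; rewrite vc /vdvd; case: (v (L j ord0)).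
Qed.
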